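(* Let $\mu$ be a partition of $m$ with $k$ parts and let $\nu$ be a partition of $n$ with $\ell$ parts. The lexicographically greatest partition labelling a Specht module occurring as a summand of $H_\mu^\nu$ is $$\bigl(n\mu_1,\ldots,n\mu_{k-1},\,n(\mu_k-1)+\nu_1,\,\nu_2,\ldots,\nu_\ell\bigr).$$ Moreover, this Specht module appears with multiplicity $1$.
   Context: Here $m,n$ are positive integers. $S^\lambda$ is the Specht module over $\mathbb{Q}$ labelled by the partition $\lambda$ (irreducible, with $S^{(r)}$ the trivial $\mathbb{Q}S_r$-module). The wreath product $S_m\wr S_n$ acts as a transitive imprimitive subgroup of $S_{mn}$. For a $\mathbb{Q}S_m$-module $W$ and a $\mathbb{Q}S_n$-module $Z$, $W\oslash Z$ is the $\mathbb{Q}(S_m\wr S_n)$-module $W^{\otimes n}\otimes Z$, where $S_m^n$ acts factorwise on $W^{\otimes n}$ and trivially on $Z$, and $S_n$ acts by permuting the tensor factors of $W^{\otimes n}$ (no signs) and by its given action on $Z$. The generalized Foulkes module is $H_\mu^\nu=(S^\mu\oslash S^\nu)\uparrow_{S_m\wr S_n}^{S_{mn}}$. *)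

(* Defs.v *)
From HB Require Import structures.
From mathcomp Require Import all_boot all_order all_algebra all_fingroup.
From mathcomp Require Import mxrepresentation character.

Set Implicit Arguments.
Unset Strict Implicit.
Unset Printing Implicit Defensive.

Import GroupScope GRing.Theory.
Local Open Scope ring_scope.

(* Modules over a group algebra are mx_representations, hence right modules   *)
(* (row vectors), in agreement with the left-to-right composition of {perm T}.*)

Definition fin_mx (F : fieldType) (I : finType) (f : I -> I -> F) : 'M[F]_#|I| :=
  \matrix_(i, j) f (enum_val i) (enum_val j).

Lemma fin_mx1 (F : fieldType) (I : finType) (f : I -> I -> F) :
  (forall i j, f i j = (i == j)%:R) -> fin_mx f = 1%:M.
Proof.
by move=> fE; apply/matrixP=> i j; rewrite !mxE fE (inj_eq enum_val_inj).
Qed.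

Lemma fin_mxM (F : fieldType) (I : finType) (f g h : I -> I -> F) :
    (forall i j, h i j = \sum_k f i k * g k j) ->
  fin_mx h = fin_mx f *m fin_mx g.
Proof.
move=> hE; apply/matrixP=> i j; rewrite !mxE hE.
rewrite [LHS](reindex (@enum_val I predT)) /=.
  by apply: eq_bigr => k _; rewrite !mxE.
by exists enum_rank => k _; rewrite ?enum_rankK ?enum_valK.
Qed.

Section Induction.

Variables (F : fieldType) (gT : finGroupType) (G H : {group gT}).
Variables (d : nat) (rH : mx_representation F H d).

Definition coset_in := {C : {set gT} | C \in rcosets H G}.

Definition ind_idx : finType := (coset_in * 'I_d)%type.

(* V (x)_FH FG has the basis v_a (x) x_C, where x_C := repr C runs over       *)
(* representatives of the right cosets C = H x_C; the action of g is          *)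
(* (v_a (x) x_C) g = v_a (x_C g x_D^-1) (x) x_D for the D with x_C g \in D.   *)
Definition ind_entry (g : gT) (u v : ind_idx) : F :=
  let h := (repr (val u.1) * g * (repr (val v.1))^-1)%g in
  if h \in H then rH h u.2 v.2 else 0.

Definition ind_mx (g : gT) : 'M[F]_#|ind_idx| := fin_mx (ind_entry g).

Hypothesis sHG : H \subset G.

Lemma repr_coset_in (C : coset_in) :
  repr (val C) \in G /\ val C = H :* repr (val C).
Proof.
case: C => C CP /=; have /rcosetsP[x Gx defC] := CP.
have rC: repr C \in C by rewrite defC mem_repr_rcoset.
split; last by move: rC; rewrite {2}defC => /rcoset_eqP->.
move: rC; rewrite {2}defC => /rcosetP[h Hh ->].
by rewrite groupM // (subsetP sHG h).
Qed.

Lemma coset_in_eq (C D : coset_in) :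
  (repr (val C) * (repr (val D))^-1 \in H)%g = (C == D).
Proof.
have [_ defC] := repr_coset_in C; have [_ defD] := repr_coset_in D.
rewrite -mem_rcoset -val_eqE /= [X in _ = (X == _)]defC [X in _ = (_ == X)]defD.
by apply/idP/eqP=> [/rcoset_eqP-> // | <-]; rewrite rcoset_refl.
Qed.

Lemma ind_mx_repr : mx_repr G ind_mx.
Proof.
split=> [|x y Gx Gy].
  apply: fin_mx1 => -[C a] [D b]; rewrite /ind_entry /= mulg1 coset_in_eq xpair_eqE.
  by case: eqP => //= ->; rewrite mulgV repr_mx1 mxE.
apply: fin_mxM => -[C a] [D b]; rewrite /ind_entry /=.
have [GC _] := repr_coset_in C.
have CX: H :* (repr (val C) * x) \in rcosets H G.
  by rewrite mem_rcosets mulSGid // groupM.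
pose E : coset_in := Sub (H :* (repr (val C) * x)) CX.
have HE: (repr (val C) * x * (repr (val E))^-1)%g \in H.
  by rewrite -mem_rcoset -(repr_coset_in E).2 rcoset_refl.
rewrite (eq_bigr (fun k : ind_idx => (fun E' c =>
   (if (repr (val C) * x * (repr (val E'))^-1)%g \in H then
      rH (repr (val C) * x * (repr (val E'))^-1)%g a c else 0) *
   (if (repr (val E') * y * (repr (val D))^-1)%g \in H then
      rH (repr (val E') * y * (repr (val D))^-1)%g c b else 0)) k.1 k.2)) //.
rewrite -(pair_bigA _ (fun E' c =>
   (if (repr (val C) * x * (repr (val E'))^-1)%g \in H then
      rH (repr (val C) * x * (repr (val E'))^-1)%g a c else 0) *
   (if (repr (val E') * y * (repr (val D))^-1)%g \in H then
      rH (repr (val E') * y * (repr (val D))^-1)%g c b else 0))) /=.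
rewrite (bigD1 E) //= addrC big1 ?add0r => [|E' neE'].
  rewrite HE.
  set h1 := (repr (val C) * x * (repr (val E))^-1)%g in HE *.
  set h2 := (repr (val E) * y * (repr (val D))^-1)%g.
  have -> : (repr (val C) * (x * y) * (repr (val D))^-1 = h1 * h2)%g.
    by rewrite /h1 /h2 !mulgA mulgKV.
  rewrite groupMl //; case: ifP => Hh2; last by rewrite big1 // => c; rewrite mulr0.
  by rewrite repr_mxM // mxE.
rewrite big1 // => c _; case: ifP => [HE'|]; last by rewrite mul0r.
case/negP: neE'; rewrite -coset_in_eq.
have := groupM (groupVr HE') HE.
by rewrite !invMg invgK !mulgA mulgKV mulgKV.
Qed.

Definition ind_repr : mx_representation F G #|ind_idx| :=
  MxRepresentation ind_mx_repr.

End Induction.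

Section Multiplicity.

Variables (F : fieldType) (gT : finGroupType) (G : {group gT}).
Variables (d : nat) (rV : mx_representation F G d).
Variables (e : nat) (rS : mx_representation F G e).

Definition submod_iso (U : 'M[F]_d) : Prop :=
  exists modU : mxmodule rV U, mx_rsim (submod_repr modU) rS.

Definition is_summand : Prop :=
  exists U W : 'M[F]_d,
    [/\ submod_iso U, mxmodule rV W, mxdirect (U + W) & (U + W :=: 1%:M)%MS].

(* For S simple: in some decomposition of V into a direct sum of simple       *)
(* submodules, exactly c of them are isomorphic to S (by Krull-Schmidt, c     *)
(* does not depend on the decomposition).                                     *)
Definition has_multiplicity (c : nat) : Prop :=
  exists (r : nat) (U : 'I_r -> 'M[F]_d) (J : {set 'I_r}),
    [/\ forall i, mxsimple rV (U i),
        mxdirect (\sum_i U i),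
        (\sum_i U i :=: 1%:M)%MS,
        forall i, i \in J <-> submod_iso (U i)
      & #|J| = c].

End Multiplicity.

(* Parts are positive, so that size la is the number of parts. *)
Definition is_partition (N : nat) (la : seq nat) : bool :=
  [&& sorted geq la, 0%N \notin la & sumn la == N].

Section Specht.

Variables (F : fieldType) (T : finType) (la : seq nat).

(* A tabloid is given by the row containing each element of T. *)
Definition is_tabloid (f : {ffun T -> 'I_(size la)}) : bool :=
  [forall r, #|[set x | f x == r]| == nth 0%N la r].

Definition tabloid := {f : {ffun T -> 'I_(size la)} | is_tabloid f}.

Definition tabloid_fun_act (f : {ffun T -> 'I_(size la)}) (s : {perm T}) :=
  [ffun x => f (s^-1%g x)].

Lemma tabloid_act_subproof (f : tabloid) s : is_tabloid (tabloid_fun_act (val f) s).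
Proof.
apply/forallP=> r; rewrite -(eqP (forallP (valP f) r)); apply/eqP.
rewrite -(card_imset [pred x | x \in [set x | val f x == r]] (@perm_inj _ s)).
apply: eq_card => x; rewrite inE ffunE; apply/idP/imsetP=> [fx | [y]].
  by exists (s^-1%g x); rewrite ?inE ?permKV.
by rewrite !inE => fy ->; rewrite permK.
Qed.

Definition tabloid_act (f : tabloid) (s : {perm T}) : tabloid :=
  Sub (tabloid_fun_act (val f) s) (tabloid_act_subproof f s).

Definition tabloid_mx (s : {perm T}) : 'M[F]_#|{: tabloid}| :=
  fin_mx (fun f g : tabloid => (tabloid_act f s == g)%:R).

Lemma tabloid_mx_repr : mx_repr [set: {perm T}] tabloid_mx.
Proof.
split=> [|s1 s2 _ _].
  apply: fin_mx1 => f g; congr (_ == _)%:R; apply/val_inj/ffunP=> x.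
  by rewrite ffunE invg1 perm1.
apply: fin_mxM => f g; rewrite (bigD1 (tabloid_act f s1)) //= eqxx mul1r.
rewrite big1 ?addr0 => [|h /negPf neh]; last by rewrite eq_sym neh mul0r.
congr (_ == _)%:R; apply/val_inj/ffunP=> x.
by rewrite !ffunE invMg permM.
Qed.

Definition tabloid_repr : mx_representation F [set: {perm T}] #|{: tabloid}| :=
  MxRepresentation tabloid_mx_repr.

(* A la-tableau is given by the position (row, column) of each element of T;  *)
(* it is a bijection onto the boxes of la as soon as #|T| = sumn la.          *)
Definition position : finType := ('I_(size la) * 'I_(head 0%N la))%type.

Definition is_tableau (t : {ffun T -> position}) : bool :=
  injectiveb t && [forall x, (t x).2 < nth 0 la (t x).1]%N.

Definition col_stab (t : {ffun T -> position}) : {set {perm T}} :=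
  [set s : {perm T} | [forall x, (t (s x)).2 == (t x).2]].

Definition rows_of (t : {ffun T -> position}) : {ffun T -> 'I_(size la)} :=
  [ffun x => (t x).1].

(* e_t = \sum_(s in C_t) sgn(s) {t} s, in the tabloid basis of tabloid_repr. *)
Definition polytabloid (t : {ffun T -> position}) : 'rV[F]_#|{: tabloid}| :=
  \row_j \sum_(s in col_stab t)
     (-1) ^+ s * (tabloid_fun_act (rows_of t) s == val (enum_val j))%:R.

Definition specht_mx : 'M[F]_#|{: tabloid}| :=
  (\sum_(t : {ffun T -> position} | is_tableau t) <<polytabloid t>>)%MS.

Definition tableau_act (t : {ffun T -> position}) (s : {perm T}) :
  {ffun T -> position} := [ffun x => t (s^-1%g x)].

Lemma is_tableau_act t s : is_tableau t -> is_tableau (tableau_act t s).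
Proof.
case/andP=> /injectiveP t_inj /forallP t_lt; apply/andP; split.
  by apply/injectiveP=> x y; rewrite !ffunE => /t_inj/perm_inj.
by apply/forallP=> x; rewrite ffunE.
Qed.

Lemma polytabloid_act t s :
  polytabloid t *m tabloid_repr s = polytabloid (tableau_act t s).
Proof.
apply/rowP=> j; rewrite !mxE.
pose f0 := enum_val j; pose f1 := tabloid_act f0 s^-1%g.
have f1E f : (tabloid_act f s == f0) = (f == f1).
  apply/eqP/eqP=> [E | ->]; apply/val_inj/ffunP=> x; rewrite ?/f1 -?E !ffunE.
    by rewrite invgK permK.
  by rewrite invgK permKV.
rewrite (bigD1 (enum_rank f1)) //= big1 ?addr0 => [|i ne_i]; last first.
  rewrite [X in _ * X]mxE f1E -(inj_eq enum_rank_inj) enum_valK.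
  by rewrite (negPf ne_i) mulr0.
rewrite !mxE enum_rankK f1E eqxx mulr1.
rewrite [RHS](reindex_inj (conjg_inj s)) /=.
apply: eq_big => [p|p _].
  rewrite !inE; apply/forallP/forallP=> H x.
    rewrite !ffunE /conjg !permM permK.
    exact: H.
  by have := H (s x); rewrite !ffunE /conjg !permM !permK.
rewrite odd_permJ; congr (_ * _%:R).
rewrite -/f0; congr nat_of_bool; apply/eqP/eqP=> /ffunP E.
  apply/ffunP=> x; have := E (s^-1%g x); rewrite !ffunE.
  by rewrite invgK permKV -conjVg /conjg !permM permK => <-.
apply/ffunP=> x; have := E (s x); rewrite !ffunE.
by rewrite invgK -conjVg /conjg !permM !permK => <-.
Qed.

Lemma specht_module : mxmodule tabloid_repr specht_mx.
Proof.
apply/mxmoduleP=> s _; rewrite sumsmxMr_gen; apply/sumsmx_subP=> t tP.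
rewrite genmxE; have /eqmxMr-> := genmxE (polytabloid t).
rewrite polytabloid_act (sumsmx_sup (tableau_act t s)) ?is_tableau_act //.
by rewrite genmxE.
Qed.

(* This is the Specht module when la is a partition of #|T|. *)
Definition specht_repr : mx_representation F [set: {perm T}] (\rank specht_mx) :=
  submod_repr specht_module.

End Specht.

(* S_{mn} is taken to be the symmetric group on the set 'I_n * 'I_m of size   *)
(* mn; the blocks of imprimitivity are the n fibres of the first projection.  *)
Section Wreath.

Variables (m n : nat).

Definition wr_fun (p : {ffun 'I_n -> 'S_m} * 'S_n) (x : 'I_n * 'I_m) :=
  (p.2 x.1, p.1 x.1 x.2).

Lemma wr_fun_inj p : injective (wr_fun p).
Proof. by move=> [i x] [j y] [/perm_inj<- /perm_inj->]. Qed.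

(* (a, t) maps (i, x) to (t i, a_i x). *)
Definition wr_perm p : {perm 'I_n * 'I_m} := perm (@wr_fun_inj p).

Definition wr_mul (p q : {ffun 'I_n -> 'S_m} * 'S_n) :
    {ffun 'I_n -> 'S_m} * 'S_n :=
  ([ffun i => p.1 i * q.1 (p.2 i)], p.2 * q.2)%g.

Lemma wr_permM p q : wr_perm (wr_mul p q) = (wr_perm p * wr_perm q)%g.
Proof.
by apply/permP=> -[i x]; rewrite permM !permE /wr_fun /= ffunE !permM.
Qed.

Lemma wr_perm1 : wr_perm ([ffun=> 1%g], 1%g) = 1%g.
Proof. by apply/permP=> -[i x]; rewrite !permE /wr_fun /= ffunE !perm1. Qed.

Definition wreath : {set {perm 'I_n * 'I_m}} := [set wr_perm p | p in predT].

Lemma wreath_group_set : group_set wreath.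
Proof.
apply/group_setP; split; first by apply/imsetP; exists ([ffun=> 1%g], 1%g); rewrite ?wr_perm1.
move=> _ _ /imsetP[p _ ->] /imsetP[q _ ->].
by apply/imsetP; exists (wr_mul p q); rewrite ?wr_permM.
Qed.

Canonical wreath_group := group wreath_group_set.

(* For m > 0 this inverts wr_perm on wreath. *)
Definition wr_coord (s : {perm 'I_n * 'I_m}) : {ffun 'I_n -> 'S_m} * 'S_n :=
  odflt ([ffun=> 1%g], 1%g) [pick p | wr_perm p == s].

Hypothesis m_gt0 : (0 < m)%N.

Lemma wr_perm_inj : injective wr_perm.
Proof.
move=> [a s] [b t] E.
have Ei i x : (s i, a i x) = (t i, b i x).
  by have /permP/(_ (i, x)) := E; rewrite !permE.
congr (_, _); last by apply/permP=> i; case: (Ei i (Ordinal m_gt0)).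
by apply/ffunP=> i; apply/permP=> x; case: (Ei i x).
Qed.

Lemma wr_permK p : wr_coord (wr_perm p) = p.
Proof.
by rewrite /wr_coord; case: pickP => [q /eqP/wr_perm_inj | /(_ p)/eqP].
Qed.

Section TensorPower.

Variables (F : fieldType) (d : nat).
Variable rW : mx_representation F [set: 'S_m] d.

Definition pow_idx : finType := {ffun 'I_n -> 'I_d}.

(* (e_(f 0) (x) ... (x) e_(f n.-1)) wr_perm (a, t) has the vector             *)
(* e_(f i) (a i) as its tensor factor at position t i.                        *)
Definition pow_mx (s : {perm 'I_n * 'I_m}) : 'M[F]_#|pow_idx| :=
  let: (a, t) := wr_coord s in
  fin_mx (fun f g : pow_idx => \prod_i rW (a i) (f i) (g (t i))).

Lemma pow_mx_repr : mx_repr wreath pow_mx.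
Proof.
split.
  rewrite /pow_mx -wr_perm1 wr_permK; apply: fin_mx1 => f g.
  rewrite (eq_bigr (fun i => (f i == g i)%:R)); last first.
    by move=> i _; rewrite ffunE perm1 repr_mx1 mxE.
  have [-> | /eqP neq] := eqVneq f g; first by rewrite big1 // => i; rewrite eqxx.
  have [i ne_i]: exists i, f i != g i.
    apply/existsP; apply: contraT; rewrite negb_exists => /forallP E.
    by case: neq; apply/ffunP=> i; apply/eqP; rewrite -[_ == _]negbK.
  by rewrite (bigD1 i) //= (negPf ne_i) mul0r.
move=> _ _ /imsetP[[a s] _ ->] /imsetP[[b t] _ ->].
rewrite /pow_mx -wr_permM !wr_permK; apply: fin_mxM => f g /=.
rewrite (eq_bigr (fun i => \sum_c rW (a i) (f i) c * rW (b (s i)) c (g (t (s i))))).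
  rewrite bigA_distr_bigA /= (reindex (fun h : pow_idx => [ffun i => h (s i)])) /=.
    apply: eq_bigr => h _; rewrite big_split /=; congr (_ * _).
      by apply: eq_bigr => i _; rewrite ffunE.
    rewrite [RHS](reindex_inj (@perm_inj _ s)) /=.
    by apply: eq_bigr => i _; rewrite ffunE.
  exists (fun h : pow_idx => [ffun i => h (s^-1%g i)]) => h _; apply/ffunP=> i.
    by rewrite !ffunE permKV.
  by rewrite !ffunE permK.
by move=> i _; rewrite ffunE repr_mxM ?inE // permM mxE.
Qed.

Definition pow_repr : mx_representation F wreath #|pow_idx| :=
  MxRepresentation pow_mx_repr.

End TensorPower.

Section Inflation.

Variables (F : fieldType) (e : nat).
Variable rZ : mx_representation F [set: 'S_n] e.

Definition infl_mx (s : {perm 'I_n * 'I_m}) : 'M[F]_e := rZ (wr_coord s).2.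

Lemma infl_mx_repr : mx_repr wreath infl_mx.
Proof.
split; first by rewrite /infl_mx -wr_perm1 wr_permK repr_mx1.
move=> _ _ /imsetP[p _ ->] /imsetP[q _ ->].
by rewrite /infl_mx -wr_permM !wr_permK repr_mxM ?inE.
Qed.

Definition infl_repr : mx_representation F wreath e :=
  MxRepresentation infl_mx_repr.

End Inflation.

(* W^{(x)n} (x) Z; the base group acts trivially on Z through wr_coord. *)
Definition oslash_repr (F : fieldType) (d e : nat)
    (rW : mx_representation F [set: 'S_m] d)
    (rZ : mx_representation F [set: 'S_n] e) :=
  prod_repr (pow_repr rW) (infl_repr rZ).

Definition foulkes_repr (mu nu : seq nat) :=
  ind_repr (oslash_repr (specht_repr rat 'I_m mu) (specht_repr rat 'I_n nu))
    (subsetT wreath_group).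

End Wreath.

(* Main.v *)
Require Import Defs.
From mathcomp Require Import all_boot all_order all_algebra all_fingroup.
From mathcomp Require Import mxrepresentation character.
From mathcomp Require Import pgroup zify.
From Stdlib Require Import Classical_Prop.

(* Write S_F for the stabilizer of a colouring F of the set I_n * I_m, and a_F
   for the sum of the elements of S_F.  Let e be the
   vector e_t (x) ... (x) e_t (x) e_s of S^mu (/) S^nu, where t and s are fixed
   tableaux; it generates the induced module H, so the S_F-fixed vectors of H
   are spanned by the e a_{F g} g.

   If e a_F <> 0, then no element of S_F negates e.  Hence the colours are
   distinct in every column of every copy of t, and two copies in the same
   column of s are coloured differently.  Counting colours, this excludes every
   content lexicographically greater than la, and, if the content is la, it
   forces F to be F0 up to group elements that fix e up to sign.
   Here F0 colours a box of each copy of t by its row, except for one box y of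
   the last row, whose colour in the i-th copy is k - 1 plus the row of i in s.
   So H has no nonzero S_F-fixed vector when F has content greater than la, and
   the S_F0-fixed vectors form the line spanned by v = e a_F0.  As S^ka always
   has a nonzero vector fixed by the row stabilizer of a ka-tableau, this
   yields the maximality of la and bounds the multiplicity of S^la by 1.

   That S^la does occur follows from v kappa <> 0, where kappa is the signed
   column sum of a la-tableau with rows F0: v is annihilated by the raising
   maps to S_F-fixed vectors with F of greater content, and this relation shows
   that v kappa <> 0 by adding the boxes to the antisymmetrizer one at a time.
   So the map M^la -> H that sends the tabloid F0 to v does not vanish on the
   simple module S^la. *)

Set Implicit Arguments.
Unset Strict Implicit.
Unset Printing Implicit Defensive.

Import GRing.Theory.

(** * Sorting colourings along columns *)

Section Sorting.

Variable T : finType.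

Lemma sum_tperm_lt (f w : T -> nat) a b : w a < w b -> f b < f a ->
  \sum_x f x * w x < \sum_x f (tperm a b x) * w x.
Proof.
move=> ltw ltf; have neq : b != a by apply: contraTneq ltw => ->; rewrite ltnn.
rewrite (bigD1 a) //= (bigD1 b) //= [ltnRHS](bigD1 a) //= [in ltnRHS](bigD1 b) //=.
rewrite tpermL tpermR !addnA [in ltnRHS](eq_bigr (fun x => f x * w x)).
  by rewrite ltn_add2r; nia.
by move=> x /andP[xa xb]; rewrite tpermD // eq_sym.
Qed.

(** The element [g] maximizes the sum of [f (g x) * w x] over [N]; exchanging two values in the
    wrong order would raise this sum. The transposition itself need not lie in [N]: some [h] in [N]
    with the same effect on the colouring suffices. *)
Lemma exists_sorting_perm (N : {group {perm T}}) (f w : T -> nat) :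
  exists2 g, g \in N &
    forall a b h, h \in N -> (forall x, f (g (h x)) = f (g (tperm a b x))) ->
      w a < w b -> f (g a) <= f (g b).
Proof.
have [g gN gmax] :=
  @arg_maxnP {perm T} 1%g (mem N) (fun g : {perm T} => \sum_x f (g x) * w x) (group1 N).
exists g => // a b h hN fh ltw; rewrite leqNgt; apply/negP => ltf.
have /= := gmax (h * g)%g (groupM hN gN).
rewrite leqNgt => /negP; apply.
rewrite [ltnRHS](eq_bigr (fun x => f (g (tperm a b x)) * w x)) => [|x _].
  exact: (@sum_tperm_lt (fun x => f (g x))).
by rewrite permM fh.
Qed.

Variables (C : eqType) (row : T -> nat) (col : T -> C).
Hypothesis col_down : forall x r, r < row x -> exists2 y, col y = col x & row y = r.

Variable f : T -> nat.
Hypothesis f_inc : forall x y, col x = col y -> row x < row y -> f x < f y.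

(** The column of [x] has an element in every earlier row, and colours strictly increase along
    them. *)
Lemma sorted_ge x : row x <= f x.
Proof.
move: {2}(row x) (erefl (row x)) => r; elim: r x => [|r IH] x rx; first by rewrite rx.
have [y cy ry] : exists2 y, col y = col x & row y = r by apply: col_down; rewrite rx.
have := IH y ry; have := @f_inc y x cy; lia.
Qed.

(** By induction the colours below [a] are exactly the rows below [a]. No colour is smaller than its
    row, so colour [a] occurs only in row [a], and the count leaves out no element of that row. *)
Lemma sorted_lex K :
  (forall a, a < K ->
     (forall b, b < a -> #|[set x | f x == b]| = #|[set x | row x == b]|) ->
     #|[set x | row x == a]| <= #|[set x | f x == a]|) ->
  forall a, a < K -> forall x, (f x == a) = (row x == a).
Proof.
move=> lexK a; elim/ltn_ind: a => a IH aK.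
have sub : [set x | f x == a] \subset [set x | row x == a].
  apply/subsetP => x; rewrite !inE => /eqP fx; have := sorted_ge x.
  rewrite fx leq_eqVlt => /orP[// | lt_xa].
  by have := IH _ lt_xa (ltn_trans lt_xa aK) x; rewrite eqxx fx gtn_eqF.
have /eqP E : [set x | f x == a] == [set x | row x == a].
  rewrite eqEcard sub; apply: lexK => // b ltb; congr #|pred_of_set _|.
  by apply/setP => x; rewrite !inE IH // (ltn_trans ltb).
by move=> x; move/setP/(_ x): E; rewrite !inE.
Qed.

End Sorting.

Lemma card_comp_perm (T : finType) (F : T -> nat) (g : {perm T}) (a : nat) :
  #|[set p | F (g p) == a]| = #|[set p | F p == a]|.
Proof.
rewrite -(card_imset [set p | F (g p) == a] (@perm_inj _ g)).
congr #|pred_of_set _|; apply/setP => p; rewrite inE; apply/imsetP/idP => [[q] | Fp].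
  by rewrite inE => H ->.
by exists (g^-1%g p); rewrite ?inE permKV.
Qed.

(** * Rigidity of a sorted colouring with lexicographically large content *)

Section Core.

Variables m n : nat.
Implicit Types (i j : 'I_n) (x z : 'I_m).

Variables (rt ct : 'I_m -> nat) (rs cs : 'I_n -> nat).
Hypothesis t_down : forall x r, r < rt x -> exists2 z, ct z = ct x & rt z = r.
Hypothesis s_down : forall i r, r < rs i -> exists2 j, cs j = cs i & rs j = r.

Variables (k : nat) (y : 'I_m).
Hypothesis rt_le : forall x, rt x <= k.
Hypothesis rt_y : rt y = k.

(** Rows are counted from 0, so [k] is one less than the number of parts. The colouring F0 is the
    case [tp = rs]; other [tp] occur while the colours of the marks are still unknown. *)
Definition marked_coloring (tp : 'I_n -> nat) (p : 'I_n * 'I_m) : nat :=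
  if p.2 == y then k + tp p.1 else rt p.2.

Lemma card_marked_coloring tp a :
  #|[set p | marked_coloring tp p == a]| =
    #|[set p : 'I_n * 'I_m | (p.2 != y) && (rt p.2 == a)]|
    + (if k <= a then #|[set i | tp i == a - k]| else 0).
Proof.
pose B := [set p : 'I_n * 'I_m | (p.2 != y) && (rt p.2 == a)].
pose A := if k <= a then [set i | tp i == a - k] else set0.
have -> : (if k <= a then #|[set i | tp i == a - k]| else 0) = #|[set (i, y) | i in A]|.
  rewrite card_imset; last by move=> i j [].
  by rewrite /A; case: ifP => // _; rewrite cards0.
have -> : [set p | marked_coloring tp p == a] = B :|: [set (i, y) | i in A].
  apply/setP => -[i x]; rewrite !inE /marked_coloring /=.
  have -> : ((i, x) \in [set (i0, y) | i0 in A]) = (x == y) && (i \in A).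
    apply/imsetP/andP => [[j jA [-> ->]] // | [/eqP-> iA]]; by exists i.
  case: (eqVneq x y) => _ /=; last by rewrite orbF.
  rewrite /A; case: ifP => lk; rewrite inE; lia.
rewrite cardsU disjoint_setI0 ?cards0 ?subn0 //.
rewrite disjoints_subset; apply/subsetP => -[i x]; rewrite !inE /=.
move=> /andP[ny _]; apply/imsetP => -[j _ [_ xy]]; by rewrite xy eqxx in ny.
Qed.

(* F_sorted holds when F maximizes, over its N-orbit, the sum of F times the weight
   that appears here. *)
Variables (N : {set {perm 'I_n * 'I_m}}) (F : 'I_n * 'I_m -> nat).

Hypothesis F_sorted : forall a b h, h \in N ->
  (forall p, F (h p) = F (tperm a b p)) ->
  rt a.2 + (a.2 == y) * (rs a.1).+1 < rt b.2 + (b.2 == y) * (rs b.1).+1 ->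
  F a <= F b.
Hypothesis N_col : forall i x z, x != z -> ct x = ct z -> tperm (i, x) (i, z) \in N.
Hypothesis F_col : forall i x z, x != z -> ct x = ct z -> F (i, x) != F (i, z).
Hypothesis N_swap : forall i x, rt x = k -> exists h,
  [/\ h \in N, h (i, x) = (i, y), h (i, y) = (i, x),
      forall p, p.1 != i -> h p = p
    & forall z, z != x -> z != y ->
        (h (i, z)).1 = i /\ (if rt z == k then (h (i, z)).2 = z
                             else rt (h (i, z)).2 = rt z)].
Hypothesis N_block : forall i j, i != j -> cs i = cs j -> exists2 h, h \in N &
  forall p, h p = (tperm i j p.1, p.2).
Hypothesis F_block : forall i j, i != j -> cs i = cs j -> exists x, F (i, x) != F (j, x).

Let F0 := marked_coloring rs.

Hypothesis F_lex : forall a,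
  (forall b, b < a -> #|[set p | F p == b]| = #|[set p | F0 p == b]|) ->
  #|[set p | F0 p == a]| <= #|[set p | F p == a]|.

Lemma core_col_inc i x z : ct x = ct z -> rt x < rt z -> F (i, x) < F (i, z).
Proof.
move=> cxz rxz; have nxz : x != z by apply: contraTneq rxz => ->; rewrite ltnn.
rewrite ltn_neqAle F_col //=.
apply: F_sorted (N_col i nxz cxz) _ _ => //=.
(* The mark [y] carries extra weight, but it lies in the last row and cannot be above [z]. *)
have [xy | _] := eqVneq x y; last by rewrite addn0; lia.
by have := rt_le z; rewrite -rt_y -xy; lia.
Qed.

Let rT (p : 'I_n * 'I_m) := rt p.2.
Let cT (p : 'I_n * 'I_m) := (p.1, ct p.2).

Lemma core_rT_down p r : r < rT p -> exists2 q, cT q = cT p & rT q = r.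
Proof.
move=> lt_r; have [z cz rz] := t_down lt_r.
by exists (p.1, z); rewrite /rT /cT /= ?cz.
Qed.

Lemma core_ge_row p : rt p.2 <= F p.
Proof.
apply: (sorted_ge core_rT_down) => -[i x] [j z] [/= <- cxz]; exact: core_col_inc.
Qed.

(** Below [k] the colour classes of [F0] are the rows, so [F_lex] supplies the counts for
    [sorted_lex]. *)
Lemma core_eq_low a p : a < k -> (F p == a) = (rt p.2 == a).
Proof.
move=> ak; move: a ak p; apply: (sorted_lex (f := F) (row := rT) core_rT_down).
  by move=> -[i x] [j z] [/= <- cxz]; apply: core_col_inc.
have E b : b < k -> [set p | F0 p == b] = [set p | rT p == b].
  move=> bk; apply/setP => -[i x]; rewrite !inE /F0 /marked_coloring /rT /=.
  by case: (eqVneq x y) => [-> | //]; rewrite rt_y; lia.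
move=> a ak eqb; rewrite -(E a ak); apply: F_lex => b ba.
by rewrite (E b (ltn_trans ba ak)) eqb.
Qed.

Lemma core_below_last p : rt p.2 < k -> F p = rt p.2.
Proof. by move=> /core_eq_low E; apply/eqP; rewrite E. Qed.

Lemma core_last_row p : rt p.2 = k -> k <= F p.
Proof. by move=> <-; exact: core_ge_row. Qed.

(** The permutation from [N_swap] stands for the exchange of the columns of [x] and [y] in copy [i].
    Above the last row colours equal rows, so its effect on [F] is that of the transposition of the
    two boxes, and the heavier one gets the larger colour. *)
Lemma core_mark_max i x : rt x = k -> F (i, x) <= F (i, y).
Proof.
move=> rx; have [-> // | xy] := eqVneq x y.
have [h [hN hx hy hD hz]] := N_swap i rx.
(* The successor in the weight makes the mark heavier than [x] even when [rs i] is 0. *)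
apply: (F_sorted hN) => [[j z] |] /=; last by rewrite (negPf xy) eqxx rx rt_y; lia.
have [-> | ji] := eqVneq j i; last by rewrite hD // tpermD // xpair_eqE eq_sym (negPf ji).
have [-> | zx] := eqVneq z x; first by rewrite hx tpermL.
have [-> | zy] := eqVneq z y; first by rewrite hy tpermR.
rewrite tpermD ?xpair_eqE ?eqxx //=; try by rewrite eq_sym.
have [h1] := hz z zx zy; rewrite (surjective_pairing (h (i, z))) h1 /=.
case: eqP => [_ -> // | /eqP nk rz].
have lz : rt z < k by rewrite ltn_neqAle nk rt_le.
by rewrite !core_below_last ?rz.
Qed.

(** If the mark of a copy has colour [k], its maximality forces [k] on the whole last row, so the
    copy is coloured by rows. *)
Lemma core_eq_block i j : F (i, y) = k -> F (j, y) = k -> forall x, F (i, x) = F (j, x).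
Proof.
have E l : F (l, y) = k -> forall x, F (l, x) = rt x.
  move=> Fl x; have := rt_le x; rewrite leq_eqVlt => /orP[/eqP rx | ltx].
    have := core_last_row (p := (l, x)) rx; have := core_mark_max l rx; lia.
  by rewrite core_below_last.
by move=> Fi Fj x; rewrite (E i Fi) (E j Fj).
Qed.

(** Each element is sent to the row 0 element of its column. *)
Lemma card_transversal_le (A : {set 'I_n}) :
  {in A &, forall i j, cs i = cs j -> i = j} -> #|A| <= #|[set i | rs i == 0]|.
Proof.
move=> Ainj.
have top i : {j | (cs j == cs i) && (rs j == 0)}.
  apply: sigW; have [r0 | rpos] := posnP (rs i).
    by exists i; rewrite r0 !eqxx.
  by have [j cj rj] := s_down rpos; exists j; rewrite cj rj !eqxx.
have <- : #|[set sval (top i) | i in A]| = #|A|.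
  apply: card_in_imset => i j iA jA.
  case: (top i) (top j) => i' /= /andP[/eqP ci _] [j' /= /andP[/eqP cj _]] eqij.
  by apply: Ainj => //; rewrite -ci eqij cj.
apply: subset_leq_card; apply/subsetP => j /imsetP[i _ ->].
by rewrite inE; case: (top i) => j' /= /andP[].
Qed.

(** By [core_eq_block] and [F_block], the copies whose mark has colour [k] lie in distinct columns
    of s, so there are at most as many as entries in the first row of s. Colour [k] occurs only on
    these marks and on the rest of the last row; the lower bound from [F_lex] then forces it on
    every unmarked box of the last row. *)
Lemma core_off_mark i x : x != y -> F (i, x) = rt x.
Proof.
move=> xy; have := rt_le x; rewrite leq_eqVlt => /orP[/eqP rx | ltx]; last by rewrite core_below_last.
pose A := [set j | F (j, y) == k].
pose B := [set p : 'I_n * 'I_m | (p.2 != y) && (rt p.2 == k)].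
have cardA : #|A| <= #|[set j | rs j == 0]|.
  apply: card_transversal_le => j j'; rewrite !inE => /eqP Fj /eqP Fj' cjj'.
  apply/eqP; apply: contraT => njj'; have [z] := F_block njj' cjj'.
  by rewrite (core_eq_block Fj Fj') eqxx.
pose A' := [set (j, y) | j in A].
have cardA' : #|A'| = #|A| by rewrite card_imset // => j j' [].
have sub : [set p | F p == k] \subset B :|: A'.
  apply/subsetP => -[j z]; rewrite !inE /= => /eqP Fz.
  have [zy | /= zy] := eqVneq z y.
    by apply/orP; right; apply/imsetP; exists j; rewrite ?inE -?zy ?Fz.
  apply/orP; left; rewrite eqn_leq rt_le leqNgt; apply/negP => lz.
  by have := core_below_last (p := (j, z)) lz; rewrite Fz => E; rewrite -E ltnn in lz.
have /eqP E : [set p | F p == k] == B :|: A'.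
  rewrite eqEcard sub /=; apply: leq_trans (F_lex (a := k) _) => [|b bk]; last first.
    congr #|pred_of_set _|; apply/setP => p; rewrite !inE core_eq_low // /F0 /marked_coloring.
    by case: (eqVneq p.2 y) => // ->; rewrite rt_y; lia.
  rewrite card_marked_coloring leqnn subnn -/B.
  by rewrite (leq_trans (leq_card_setU _ _)) // cardA' leq_add2l.
have: (i, x) \in [set p | F p == k] by rewrite E !inE /= xy rx eqxx.
by rewrite inE rx => /eqP.
Qed.

(** All other boxes being coloured by their rows, [F] amounts to a colouring [tp] of the copies, and
    [sorted_lex] applies to [tp] along the columns of s. *)
Lemma core_marked p : F p = F0 p.
Proof.
pose tp i := F (i, y) - k.
have FE q : F q = marked_coloring tp q.
  case: q => i x; rewrite /marked_coloring /tp /=.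
  by case: eqP => [-> | /eqP /core_off_mark->//]; rewrite subnKC //; exact: core_last_row.
have tp_col i j : i != j -> cs i = cs j -> tp i != tp j.
  move=> nij cij; have [x] := F_block nij cij; rewrite !FE /marked_coloring /=.
  by case: (eqVneq x y) => _; rewrite ?eqxx // eqn_add2l.
have tp_inc i j : cs i = cs j -> rs i < rs j -> tp i < tp j.
  move=> cij rij; have nij : i != j by apply: contraTneq rij => ->; rewrite ltnn.
  rewrite ltn_neqAle tp_col //=.
  have [h hN hE] := N_block nij cij.
  (* Off the marks all copies are coloured alike, so exchanging two copies has the same effect on
     [F] as exchanging their marks. *)
  rewrite leq_sub2r //; apply: (F_sorted hN) => [[l z] |] /=; last by rewrite eqxx; lia.
  rewrite hE /=; have [-> | zy] := eqVneq z y.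
    have [-> | li] := eqVneq l i; first by rewrite !tpermL.
    have [-> | lj] := eqVneq l j; first by rewrite !tpermR.
    by rewrite !tpermD ?xpair_eqE ?eqxx ?andbT // eq_sym.
  have D l' : (l', y) != (l, z) by rewrite xpair_eqE [y == z]eq_sym (negPf zy) andbF.
  by rewrite (tpermD (D i) (D j)) !core_off_mark.
have tpE a i : (tp i == a) = (rs i == a).
  apply: (sorted_lex (K := a.+1) s_down tp_inc) => // b _ eqb.
  have cF c : #|[set p | F p == c]| = #|[set p | marked_coloring tp p == c]|.
    by congr #|pred_of_set _|; apply/setP => q; rewrite !inE FE.
  (* Colour [b] of [tp] is colour [k + b] of [F]; unmarked boxes contribute equally to both
     sides. *)
  have := F_lex (a := k + b); rewrite cF !card_marked_coloring leq_addr addKn leq_add2l.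
  apply=> c cb; rewrite cF !card_marked_coloring; case: ifP => // kc.
  by rewrite eqb //; lia.
by rewrite FE /F0 /marked_coloring; congr (if _ then _ + _ else _); apply/eqP; rewrite tpE.
Qed.

End Core.

(** * Symmetrizers and antisymmetrizers *)

Section Symmetrizer.
Local Open Scope ring_scope.

Variables (K : fieldType) (T : finType) (d : nat).
Variable rX : mx_representation K [set: {perm T}] d.
Implicit Types (f : T -> nat) (g h : {perm T}).

Lemma repr_permM g h : rX (g * h)%g = rX g *m rX h.
Proof. by rewrite repr_mxM ?inE. Qed.

(** This is the Young subgroup S_F of the colour classes. *)
Definition color_stab f : {set {perm T}} := [set g : {perm T} | [forall x, f (g x) == f x]].

Lemma color_stabP f g : reflect (forall x, f (g x) = f x) (g \in color_stab f).
Proof. by rewrite inE; apply: (iffP forallP) => H x; apply/eqP; rewrite H. Qed.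

Lemma color_stab_group_set f : group_set (color_stab f).
Proof.
apply/group_setP; split; first by apply/color_stabP => x; rewrite perm1.
by move=> g h /color_stabP gf /color_stabP hf; apply/color_stabP => x; rewrite permM hf gf.
Qed.
Canonical color_stab_group f := group (color_stab_group_set f).

Lemma color_stab_comp f h g :
  (g \in color_stab f) = ((h * g * h^-1)%g \in color_stab (f \o h)).
Proof.
apply/color_stabP/color_stabP => H x /=; first by rewrite !permM permKV H.
by have := H (h^-1%g x); rewrite /= !permM !permKV.
Qed.

Definition symz f : 'M[K]_d := \sum_(g in color_stab f) rX g.

(** Conjugation by [h] turns the stabilizer of [f] into that of [f \o h]. *)
Lemma symz_comp f h : rX h *m symz f = symz (f \o h) *m rX h.
Proof.
rewrite /symz mulmx_sumr mulmx_suml [RHS](reindex_inj (conjg_inj h^-1%g)) /=.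
apply: eq_big => [g | g _]; first by rewrite (color_stab_comp f h) /conjg invgK mulgA.
by rewrite -!repr_permM /conjg invgK !mulgA mulgKV.
Qed.

Lemma symzM f h : h \in color_stab f -> symz f *m rX h = symz f.
Proof.
move=> hf; rewrite /symz mulmx_suml [RHS](reindex_inj (mulIg h)) /=.
by apply: eq_big => [g | g _]; rewrite ?groupMr ?repr_permM.
Qed.

Lemma Msymz f h : h \in color_stab f -> rX h *m symz f = symz f.
Proof.
move=> hf; rewrite /symz mulmx_sumr [RHS](reindex_inj (mulgI h)) /=.
by apply: eq_big => [g | g _]; rewrite ?groupMl ?repr_permM.
Qed.

Lemma symz_fixed f p (v : 'M_(p, d)) :
  {in color_stab f, forall h, v *m rX h = v} -> v *m symz f = #|color_stab f|%:R *: v.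
Proof.
move=> vf; rewrite /symz mulmx_sumr (eq_bigr (fun=> v)) //.
by rewrite sumr_const scaler_nat.
Qed.

(** * Nonvanishing of a highest vector under the column antisymmetrizer *)

Section Antisymmetrizer.

Variables (row col : T -> nat).

(** The support is restricted to [D] so that the full column group can be built up box by box. *)
Definition col_group (D : {set T}) : {set {perm T}} :=
  [set g : {perm T} | [forall x, (col (g x) == col x) && ((x \notin D) ==> (g x == x))]].

Lemma col_groupP (D : {set T}) g :
  reflect (forall x, col (g x) = col x /\ (x \notin D -> g x = x)) (g \in col_group D).
Proof.
rewrite inE; apply: (iffP forallP) => H x.
  by have /andP[/eqP-> /implyP H2] := H x; split=> // /H2/eqP.
by have [-> H2] := H x; rewrite eqxx; apply/implyP => /H2->.
Qed.

Definition antisymz (D : {set T}) : 'M[K]_d :=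
  \sum_(g in col_group D) (-1) ^+ g *: rX g.

Lemma col_group_group_set D : group_set (col_group D).
Proof.
apply/group_setP; split; first by apply/col_groupP => x; rewrite perm1.
move=> g h /col_groupP gD /col_groupP hD; apply/col_groupP => x; rewrite permM.
have [hc hf] := hD (g x); have [gc gf] := gD x; split; first by rewrite hc.
by move=> xD; rewrite gf // in hf *; rewrite hf.
Qed.
Canonical col_group_group D := group (col_group_group_set D).

Lemma tperm_col_group (D : {set T}) x z : x \in D -> z \in D -> col x = col z ->
  tperm x z \in col_group D.
Proof.
move=> xD zD cxz; apply/col_groupP => u; case: tpermP => [-> | -> | _ _];
  by rewrite ?xD ?zD.
Qed.

Lemma Mantisymz (D : {set T}) g : g \in col_group D ->
  rX g *m antisymz D = (-1) ^+ g *: antisymz D.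
Proof.
move=> gD; rewrite /antisymz mulmx_sumr scaler_sumr.
rewrite [RHS](reindex_inj (mulgI g)) /=.
apply: eq_big => [h | h _]; first by rewrite groupMl.
by rewrite -scalemxAr -repr_permM scalerA -signr_addb odd_permM addbA addbb.
Qed.

(** Every [g] in the larger group is [tperm z b] followed by an element of [col_group D], where [b]
    is the preimage of [z] under [g]. *)
Lemma antisymz_setU1 (D : {set T}) z : z \notin D ->
  antisymz (z |: D) =
    \sum_(b | (b \in z |: D) && (col b == col z))
       (-1) ^+ (b != z) *: (rX (tperm z b) *m antisymz D).
Proof.
move=> zD; rewrite /antisymz.
rewrite (partition_big (fun g : {perm T} => (g^-1)%g z)
          (fun b => (b \in z |: D) && (col b == col z))) /=; last first.
  move=> g /col_groupP gD; have [] := gD (g^-1%g z); rewrite permKV => -> H.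
  rewrite eqxx andbT; apply: contraT => /[dup] nD /H E.
  by move: nD; rewrite -E setU11.
apply: eq_bigr => b /andP[bD /eqP cb].
rewrite mulmx_sumr scaler_sumr [LHS](reindex_inj (mulgI (tperm z b))) /=.
have tG : tperm z b \in col_group (z |: D) by rewrite tperm_col_group ?setU11.
apply: eq_big => [h | h _]; last first.
  rewrite -scalemxAr repr_permM scalerA -signr_addb.
  by rewrite odd_mul_tperm eq_sym.
rewrite groupMl // invMg permM tpermV.
apply/andP/idP => [[/col_groupP hD /eqP hz] | /col_groupP hD].
  have {}hz : h z = z.
    by have /(congr1 (tperm z b)) := hz; rewrite tpermK tpermR => /(congr1 h); rewrite permKV.
  apply/col_groupP => x; have [-> H] := hD x; split=> // xD.
  have [-> // | xz] := eqVneq x z; apply: H.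
  by rewrite !inE negb_or xz.
have hz : h z = z by have [_ ->] := hD z.
split; last by rewrite -[X in (h^-1)%g X]hz permK tpermL.
apply/col_groupP => x; have [-> H] := hD x; split=> // xD.
by apply: H; apply: contra xD => xD; rewrite inE xD orbT.
Qed.

Hypothesis rc_inj : forall x z, col x = col z -> row x = row z -> x = z.
Hypothesis row_left : forall x c, (c < col x)%N -> exists2 z, col z = c & row z = row x.

Variable v : 'rV[K]_d.
Hypothesis v_fixed : {in color_stab row, forall h, v *m rX h = v}.
(* Moving one element x of row j to an earlier row i and symmetrizing annihilates v. *)
Hypothesis v_raise : forall x i, (i < row x)%N ->
  v + \sum_(z | row z == i) v *m rX (tperm z x) = 0.
Hypothesis charK : [pchar K] =i pred0.
Hypothesis v_neq0 : v != 0.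

Lemma tperm_row_fixed x z : row x = row z -> v *m rX (tperm x z) = v.
Proof.
move=> rxz; apply: v_fixed; apply/color_stabP => u.
by case: tpermP => [-> | -> | _ _].
Qed.

Lemma antisymz_tperm_comm (D : {set T}) x z : x \notin D -> z \notin D ->
  rX (tperm x z) *m antisymz D = antisymz D *m rX (tperm x z).
Proof.
move=> xD zD; rewrite /antisymz mulmx_sumr mulmx_suml; apply: eq_bigr => g.
move/col_groupP => gD; rewrite -scalemxAr -scalemxAl -!repr_permM.
congr (_ *: rX _); apply/permP => u; rewrite !permM.
have gx : g x = x by apply: (gD x).2.
have gz : g z = z by apply: (gD z).2.
have [-> | ux] := eqVneq u x; first by rewrite gx !tpermL gz.
have [-> | uz] := eqVneq u z; first by rewrite gz !tpermR gx.
rewrite !tpermD //; rewrite eq_sym //.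
  by rewrite -gx (inj_eq perm_inj).
by rewrite -gz (inj_eq perm_inj).
Qed.

(* If v *m antisymz (z |: D) vanished, so would its conjugates by the row of z
   outside D; their sum is (#|A| + #|B|) *: (v *m antisymz D), because v_raise
   evaluates the sums over the row of z, where the terms from earlier columns are
   killed by a column transposition. *)
Lemma antisymz_step (D : {set T}) z : z \notin D ->
  (forall x, (col x < col z)%N -> x \in D) ->
  (forall x, x \in D -> (col x < col z)%N \/ col x = col z /\ (row z < row x)%N) ->
  v *m antisymz D != 0 -> v *m antisymz (z |: D) != 0.
Proof.
move=> zD D_left D_sub; apply: contra_neq => vz0.
pose u := v *m antisymz D.
pose B := [set b in D | col b == col z].
pose A := [set x | (row x == row z) && (x \notin D)].
have zB : z \notin B by rewrite inE (negPf zD).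
have vzE : u = \sum_(b in B) v *m rX (tperm z b) *m antisymz D.
  apply/eqP; rewrite -subr_eq0; apply/eqP; rewrite -[RHS]vz0 antisymz_setU1 // mulmx_sumr.
  rewrite [in RHS](bigD1 z) /= ?setU11 ?eqxx // tperm1 repr_mx1 mul1mx scale1r.
  rewrite -sumrN; congr (_ + _); apply: eq_big => [b | b bB].
    rewrite !inE; case: (eqVneq b z) => [-> | _]; last by rewrite andbT.
    by rewrite (negPf zD) andbF.
  have -> : b != z by apply: contraTneq bB => ->.
  by rewrite scaleN1r mulmxN mulmxA.
have allA x : x \in A -> u = \sum_(b in B) v *m rX (tperm x b) *m antisymz D.
  rewrite inE => /andP[/eqP rx xD].
  have tf := tperm_row_fixed rx.
  have -> : u = u *m rX (tperm x z).
    by rewrite /u -mulmxA -antisymz_tperm_comm // mulmxA tf.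
  rewrite {1}vzE mulmx_suml; apply: eq_bigr => b bB.
  rewrite -mulmxA -antisymz_tperm_comm // !mulmxA; congr (_ *m _).
  rewrite -[in LHS]tf -!mulmxA -!repr_permM; congr (_ *m rX _).
  have bD : b \in D by move: bB; rewrite inE => /andP[].
  have bx : b != x by apply: contraNneq xD => <-.
  have bz : b != z by apply: contraNneq zD => <-.
  have -> : tperm x b = (tperm z b ^ tperm x z)%g.
    by rewrite tpermJ tpermR tpermD // eq_sym.
  by rewrite conjgE tpermV.
have sumA b : b \in B -> \sum_(x in A) v *m rX (tperm x b) *m antisymz D = - u.
  rewrite inE => /andP[bD /eqP cb].
  have rb : (row z < row b)%N by case: (D_sub b bD) => [|[]//]; rewrite cb ltnn.
  apply/eqP; rewrite -addr_eq0 addrC; apply/eqP.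
  transitivity ((v + \sum_(x | row x == row z) v *m rX (tperm x b)) *m antisymz D);
    last by rewrite v_raise // mul0mx.
  rewrite mulmxDl; congr (_ + _); rewrite mulmx_suml.
  rewrite [RHS](bigID (mem D)) /= [X in _ = X + _]big1 ?add0r => [|x /andP[/eqP rx xD]].
    by apply: eq_bigl => x; rewrite inE.
  have cx : (col x < col z)%N by case: (D_sub x xD) => // -[_]; rewrite rx ltnn.
  have [x' cx' rx'] : exists2 x', col x' = col x & row x' = row b.
    by apply: row_left; rewrite cb.
  have x'D : x' \in D by apply: D_left; rewrite cx'.
  have E : v *m rX (tperm x b) = v *m rX (tperm x b) *m rX (tperm x x').
    rewrite -[in LHS](tperm_row_fixed (esym rx')) -!mulmxA -!repr_permM.
    congr (_ *m rX _); rewrite -{1}[tperm x b]tpermV.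
    have -> : tperm x x' = (tperm b x' ^ tperm x b)%g.
      rewrite tpermJ tpermR tpermD //; last by apply: contraTneq cx => E; rewrite -cx' -E cb ltnn.
      by apply: contraTneq rb => E; rewrite -rx' -E rx ltnn.
    by rewrite conjgE !mulgA tpermV tperm2 mul1g.
  have : v *m rX (tperm x b) *m antisymz D = - (v *m rX (tperm x b) *m antisymz D).
    rewrite {1}E -mulmxA Mantisymz ?tperm_col_group // odd_tperm.
    have -> : x != x' by apply: contraTneq rb => xx'; rewrite -rx' -xx' rx ltnn.
    by rewrite scaleN1r mulmxN.
  move/eqP; rewrite -subr_eq0 opprK -mulr2n -scaler_nat scaler_eq0.
  by have /pcharf0P-> := charK; move/eqP.
have : (#|A| + #|B|)%N%:R *: u = 0.
  rewrite natrD scalerDl !scaler_nat -!sumr_const (eq_bigr _ allA) exchange_big /=.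
  rewrite (eq_bigr (fun=> - u)) => [|b bB]; last by rewrite sumA.
  by rewrite sumrN addNr.
move/eqP; rewrite scaler_eq0; have /pcharf0P-> := charK.
rewrite addn_eq0 cards_eq0 => /orP[/andP[/eqP A0 _] | /eqP//].
by have := in_set0 z; rewrite -A0 inE eqxx zD.
Qed.

(* The boxes are added column by column, each column from the bottom up. *)
Lemma antisymz_neq0 : v *m antisymz setT != 0.
Proof.
(* As [M] exceeds every row number, [key] orders the boxes by column first and by decreasing row
   within a column. *)
pose M := (\max_x row x)%N.+1.
have rowM x : (row x < M)%N by rewrite ltnS leq_bigmax.
pose key x := (col x * M + (M.-1 - row x))%N.
have keyP x z : (key x < key z)%N -> (col x < col z)%N \/ col x = col z /\ (row z < row x)%N.
  have := rowM x; have := rowM z; rewrite /key.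
  by case: (ltngtP (col x) (col z)) => [|| ->]; [left| nia | lia].
have key_col x z : (col x < col z)%N -> (key x < key z)%N.
  have := rowM x; have := rowM z; rewrite /key; nia.
have key_inj x z : key x = key z -> x = z.
  have := rowM x; have := rowM z; rewrite /key => h1 h2 E.
  suff cxz : col x = col z by apply: rc_inj => //; move: E; rewrite cxz; lia.
  by case: (ltngtP (col x) (col z)) => //; nia.
have step q : v *m antisymz [set x | (key x < q)%N] != 0.
  elim: q => [|q IH].
    rewrite /antisymz (big_pred1 1%g) => [|g].
      by rewrite odd_perm1 scale1r repr_mx1 mulmx1.
    apply/col_groupP/eqP => [H | -> x]; last by rewrite perm1.
    by apply/permP => x; rewrite perm1 (H x).2 // inE ltn0.
  have [/existsP[z /eqP zq] | no] := boolP [exists z, key z == q].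
    have -> : [set x | (key x < q.+1)%N] = z |: [set x | (key x < q)%N].
      apply/setP => x; rewrite !inE ltnS leq_eqVlt; congr (_ || _).
      by apply/eqP/eqP => [E | ->//]; apply: key_inj; rewrite E zq.
    apply: antisymz_step; rewrite ?inE ?zq ?ltnn //.
      by move=> x /key_col; rewrite inE zq.
    by move=> x; rewrite inE -zq => /keyP.
  have -> // : [set x | (key x < q.+1)%N] = [set x | (key x < q)%N].
  apply/setP => x; rewrite !inE ltnS leq_eqVlt; case: eqP => // E.
  by case/existsP: no; exists x; rewrite E.
have -> // : setT = [set x | (key x < (\max_x key x).+1)%N].
by apply/setP => x; rewrite !inE ltnS leq_bigmax.
Qed.

End Antisymmetrizer.
End Symmetrizer.

(** * Tableaux and Specht modules *)

Section Tableaux.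

Variables (T : finType) (la : seq nat).
Hypothesis la_part : is_partition #|T| la.

Lemma partition_nth_mono i j : i <= j -> nth 0 la j <= nth 0 la i.
Proof.
move=> ij; have [lj | ] := ltnP j (size la); last by move=> /(nth_default 0)->.
have /and3P[la_sorted _ _] := la_part.
apply: (@sorted_leq_nth _ geq _ leqnn 0 la la_sorted i j (leq_ltn_trans ij lj) lj ij).
by move=> a b c /= ba ac; exact: leq_trans ac ba.
Qed.

Lemma partition_nth_head i : nth 0 la i <= head 0 la.
Proof. by rewrite -nth0 partition_nth_mono. Qed.

Lemma partition_nth_gt0 i : (0 < nth 0 la i) = (i < size la).
Proof.
have [li | ] := ltnP i (size la); last by move=> /(nth_default 0)->.
have /and3P[_ n0 _] := la_part; rewrite lt0n; apply: contra n0 => /eqP <-.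
exact: mem_nth.
Qed.

Definition boxes : {set position la} := [set p : position la | p.2 < nth 0 la p.1].

Lemma card_boxes : #|boxes| = #|T|.
Proof.
have /and3P[_ _ /eqP<-] := la_part.
transitivity (\sum_(i < size la) \sum_(j < head 0 la | j < nth 0 la i) 1).
  by rewrite pair_big_dep -sum1_card; apply: eq_bigl => p; rewrite inE.
rewrite sumnE (big_nth 0) big_mkord; apply: eq_bigr => i _.
have := big_ord_widen (op := addn) (idx := 0) _ (fun=> 1%N) (partition_nth_head i).
by move=> <-; rewrite sum1_card card_ord.
Qed.

Lemma exists_tableau : exists t : {ffun T -> position la}, is_tableau t.
Proof.
pose b (x : T) := enum_val (cast_ord (esym card_boxes) (enum_rank x)).
exists [ffun x => b x]; apply/andP; split.
  by apply/injectiveP => x z; rewrite !ffunE => /enum_val_inj/cast_ord_inj/enum_rank_inj.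
by apply/forallP => x; rewrite ffunE;
  have := enum_valP (cast_ord (esym card_boxes) (enum_rank x)); rewrite inE.
Qed.

(** The column of [x] is its index in the enumeration of its colour class. *)
Lemma exists_tableau_rows (f : T -> nat) :
  (forall r, #|[set x | f x == r]| = nth 0 la r) ->
  exists2 t : {ffun T -> position la}, is_tableau t & forall x, (t x).1 = f x :> nat.
Proof.
move=> fc; pose A x := [set z | f z == f x].
have xA x : x \in enum (A x) by rewrite mem_enum inE.
have f_lt x : f x < size la.
  by rewrite -partition_nth_gt0 -fc; apply/card_gt0P; exists x; rewrite inE.
have i_lt x : index x (enum (A x)) < nth 0 la (f x).
  by rewrite -fc -/(A x) cardE index_mem.
have i_lth x : index x (enum (A x)) < head 0 la.
  exact: leq_trans (i_lt x) (partition_nth_head _).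
pose g x : position la := (Ordinal (f_lt x), Ordinal (i_lth x)).
exists [ffun x => g x]; last by move=> x; rewrite ffunE.
apply/andP; split; last by apply/forallP => x; rewrite !ffunE; exact: i_lt.
apply/injectiveP => x z; rewrite !ffunE => -[fxz].
have AA : A x = A z by rewrite /A fxz.
rewrite AA => E.
by rewrite -(nth_index x (xA x)) AA E nth_index.
Qed.

Variable t : {ffun T -> position la}.
Hypothesis t_tab : is_tableau t.

Definition tab_row (x : T) : nat := (t x).1.
Definition tab_col (x : T) : nat := (t x).2.

Lemma tableau_inj : injective t.
Proof. by have /andP[/injectiveP] := t_tab. Qed.

Lemma tableau_box x : tab_col x < nth 0 la (tab_row x).
Proof. by have /andP[_ /forallP/(_ x)] := t_tab. Qed.

Lemma tab_row_col_inj x z : tab_col x = tab_col z -> tab_row x = tab_row z -> x = z.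
Proof.
move=> cxz rxz; apply: tableau_inj.
rewrite [LHS]surjective_pairing [RHS]surjective_pairing.
by congr (_, _); apply: val_inj.
Qed.

Lemma tableau_onto (p : position la) : p.2 < nth 0 la p.1 -> exists x, t x = p.
Proof.
move=> pD; suff : p \in t @: T by case/imsetP => x _ ->; exists x.
have /eqP-> : t @: T == boxes; last by rewrite inE.
rewrite eqEcard card_boxes card_imset ?leqnn ?andbT; last exact: tableau_inj.
by apply/subsetP => _ /imsetP[x _ ->]; rewrite inE tableau_box.
Qed.

Lemma tableau_onto_nat r c : c < nth 0 la r -> exists x, tab_row x = r /\ tab_col x = c.
Proof.
move=> lc; have lr : r < size la by rewrite -partition_nth_gt0 (leq_ltn_trans _ lc).
have lch : c < head 0 la by exact: leq_trans lc (partition_nth_head r).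
have [|x tx] := @tableau_onto (Ordinal lr, Ordinal lch); first exact: lc.
by exists x; rewrite /tab_row /tab_col tx.
Qed.

Lemma tableau_down x r : r < tab_row x -> exists2 z, tab_col z = tab_col x & tab_row z = r.
Proof.
move=> lr; have [|z [rz cz]] := @tableau_onto_nat r (tab_col x); last by exists z.
by apply: leq_trans (tableau_box x) _; apply: partition_nth_mono (ltnW lr).
Qed.

Lemma tableau_left x c : c < tab_col x -> exists2 z, tab_col z = c & tab_row z = tab_row x.
Proof.
move=> lc; have [|z [rz cz]] := @tableau_onto_nat (tab_row x) c; last by exists z.
exact: ltn_trans lc (tableau_box x).
Qed.

Lemma card_tab_row r : #|[set x | tab_row x == r]| = nth 0 la r.
Proof.
rewrite -[RHS]card_ord.
have H (c : 'I_(nth 0 la r)) : exists x, (tab_row x == r) && (tab_col x == c).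
  by have [x [rx cx]] := tableau_onto_nat (ltn_ord c); exists x; rewrite rx cx !eqxx.
pose g c := xchoose (H c); have gP c : tab_row (g c) = r /\ tab_col (g c) = c.
  by have /andP[/eqP rx /eqP cx] := xchooseP (H c).
rewrite -[RHS](card_imset (f := g)) => [|c c' E]; last first.
  by apply: val_inj => /=; rewrite -(gP c).2 E (gP c').2.
congr #|pred_of_set _|; apply/setP => x; rewrite inE; apply/eqP/imsetP => [rx | [c _ ->]].
  have lx : tab_col x < nth 0 la r by rewrite -rx tableau_box.
  exists (Ordinal lx) => //; apply: tab_row_col_inj; by rewrite ?(gP _).1 ?(gP _).2.
by rewrite (gP c).1.
Qed.

Lemma rows_tabloid : is_tabloid (rows_of t).
Proof.
apply/forallP => r; apply/eqP; rewrite -card_tab_row; congr #|pred_of_set _|.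
by apply/setP => x; rewrite !inE ffunE.
Qed.

Lemma tableau_act_onto t' : is_tableau t' -> exists s, t' = tableau_act t s.
Proof.
move=> t'_tab.
have H x : exists z, t z == t' x.
  by have /andP[_ /forallP/(_ x)/tableau_onto[z <-]] := t'_tab; exists z.
have gP x : t (xchoose (H x)) = t' x by apply/eqP/(xchooseP (H x)).
have g_inj : injective (fun x => xchoose (H x)).
  move=> x z E; have /andP[/injectiveP t'_inj _] := t'_tab.
  by apply: t'_inj; rewrite -!gP E.
exists (perm g_inj)^-1%g; apply/ffunP => x; rewrite ffunE invgK permE.
by rewrite gP.
Qed.

Lemma col_stabE : col_stab t = col_group tab_col [set: T].
Proof.
apply/setP => s; rewrite !inE; apply: eq_forallb => x.
by rewrite inE andbT.
Qed.

Definition tab_of : tabloid T la :=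
  exist (fun f : {ffun T -> 'I_(size la)} => is_tabloid f) (rows_of t) rows_tabloid.

Lemma card_tabloid (f : tabloid T la) a : #|[set x | val f x == a :> nat]| = nth 0 la a.
Proof.
have [la_a | la_a] := ltnP a (size la).
  rewrite -(eqP (forallP (valP f) (Ordinal la_a))).
  by congr #|pred_of_set _|; apply/setP => x; rewrite !inE -val_eqE.
rewrite nth_default //; apply/eqP; rewrite cards_eq0; apply/eqP/setP => x.
by rewrite !inE; apply: ltn_eqF; apply: leq_trans (ltn_ord _) la_a.
Qed.

Lemma tabloid_transitive (f : tabloid T la) : exists g, tabloid_act tab_of g = f.
Proof.
have [t' t'_tab t'E] := exists_tableau_rows (card_tabloid f).
have [g gE] := tableau_act_onto t'_tab; exists g; apply/val_inj/ffunP => x.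
by apply: val_inj; rewrite /= -t'E gE !ffunE.
Qed.

End Tableaux.

(** * Polytabloids and the simplicity of Specht modules *)

Section SpechtModule.
Local Open Scope ring_scope.

Variables (K : fieldType) (T : finType) (la : seq nat).
Hypothesis charK : [pchar K] =i pred0.
Hypothesis la_part : is_partition #|T| la.

Local Notation M := (tabloid_repr K T la).
Local Notation e := (@polytabloid K T la).
Local Notation S := (specht_mx K T la).

Lemma natr_eq0 n : (n%:R == 0 :> K) = (n == 0)%N.
Proof. by have /pcharf0P-> := charK. Qed.

Lemma pchar0_pgroup (gT : finGroupType) (G : {group gT}) : ([pchar K]^'.-group G)%g.
Proof. by rewrite /pgroup pcharf'_nat natr_eq0 -lt0n cardG_gt0. Qed.

Definition tab_delta (f : tabloid T la) : 'rV[K]_#|{: tabloid T la}| :=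
  delta_mx 0 (enum_rank f).

Lemma tab_delta_act f s : tab_delta f *m M s = tab_delta (tabloid_act f s).
Proof.
rewrite -rowE; apply/rowP => j; rewrite !mxE enum_rankK eqxx /=.
by rewrite -(inj_eq enum_val_inj) enum_rankK eq_sym.
Qed.

Lemma polytabloid_col (t : {ffun T -> position la}) (s : {perm T}) : s \in col_stab t ->
  e (tableau_act t s) = (-1) ^+ s *: e t.
Proof.
move=> sC; have sP x : (t (s x)).2 = (t x).2 by move: sC; rewrite inE => /forallP/(_ x)/eqP.
have sVP x : (t (s^-1%g x)).2 = (t x).2 by rewrite -sP permKV.
apply/rowP => j; rewrite !mxE mulr_sumr [RHS](reindex_inj (mulgI s)) /=.
apply: eq_big => [g | g _].
  rewrite !inE; apply/forallP/forallP => H x.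
    have := H x; rewrite !ffunE !sVP => H'.
    by rewrite permM -(sP x); have := H (s x); rewrite !ffunE !sVP.
  by have := H (s^-1%g x); rewrite !ffunE permM permKV !sVP.
rewrite mulrA -signr_addb odd_permM addbA addbb /=; congr (_ * _%:R).
congr nat_of_bool; congr (_ == _); apply/ffunP => x.
by rewrite !ffunE invMg permM.
Qed.

(** Moving whole columns along their rows changes neither the column stabilizer nor the tabloid of
    [t]. *)
Lemma polytabloid_swap (t : {ffun T -> position la}) (s : {perm T}) :
  (forall x, (t (s x)).1 = (t x).1) ->
  (forall x z, ((t (s x)).2 == (t (s z)).2) = ((t x).2 == (t z).2)) ->
  e (tableau_act t s) = e t.
Proof.
move=> sr sc; have srV x : (t (s^-1%g x)).1 = (t x).1 by rewrite -sr permKV.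
apply/rowP => j; rewrite !mxE; apply: eq_big => [g | g _].
  rewrite !inE; apply: eq_forallb => x; rewrite !ffunE.
  by rewrite -sc !permKV.
congr (_ * _%:R); congr nat_of_bool; congr (_ == _); apply/ffunP => x.
by rewrite !ffunE srV.
Qed.

(** Only the identity preserves both rows and columns, so the tabloid of [t] comes from a single
    term. *)
Lemma polytabloid_coef t (f : tabloid T la) : is_tableau t ->
  val f = rows_of t -> e t 0 (enum_rank f) = 1.
Proof.
move=> t_tab fE; rewrite mxE enum_rankK fE (bigD1 1%g) /=; last first.
  by rewrite inE; apply/forallP => x; rewrite perm1.
rewrite big1 ?addr0.
  rewrite odd_perm1 mul1r; case: eqP => // -[]; apply/ffunP => x.
  by rewrite !ffunE invg1 perm1.
move=> s /andP[]; rewrite inE => /forallP sC ns1; case: eqP => [E | _]; last by rewrite mulr0.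
case/eqP: ns1; apply/permP => x; rewrite perm1; apply: (tab_row_col_inj t_tab).
  by have /eqP E2 := sC x; rewrite /tab_col E2.
by have /ffunP/(_ (s x)) := E; rewrite /tab_row !ffunE permK => ->.
Qed.

Variable t : {ffun T -> position la}.
Hypothesis t_tab : is_tableau t.

Local Notation row := (tab_row t).
Local Notation col := (tab_col t).

Local Notation t0 := (tab_of la_part t_tab).

Lemma polytabloid_specht : (e t <= S)%MS.
Proof. by rewrite (sumsmx_sup t) // genmxE. Qed.

Lemma specht_generated m (U : 'M[K]_(m, _)) : mxmodule M U -> (e t <= U)%MS -> (S <= U)%MS.
Proof.
move=> Umod eU; apply/sumsmx_subP => t' t'_tab; rewrite genmxE.
have [s ->] := tableau_act_onto la_part t_tab t'_tab.
by rewrite -polytabloid_act mxmodule_trans ?inE.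
Qed.

Lemma polytabloid_antisymz : e t = tab_delta t0 *m antisymz M col setT.
Proof.
apply/rowP => j; rewrite mxE /antisymz mulmx_sumr summxE -col_stabE.
apply: eq_bigr => s _; rewrite -scalemxAr mxE tab_delta_act mxE eqxx /=.
by rewrite -(inj_eq enum_val_inj) enum_rankK eq_sym.
Qed.

Lemma polytabloid_row_coef s : s \in color_stab row ->
  (e t *m M s) 0 (enum_rank t0) = 1.
Proof.
move=> /color_stabP sR; rewrite polytabloid_act polytabloid_coef ?is_tableau_act //.
apply/ffunP => x; rewrite !ffunE; apply: val_inj => /=.
by have := sR (s^-1%g x); rewrite permKV.
Qed.

(** The coefficient at the tabloid of [t] is the order of the row stabilizer, because every row
    permutation contributes 1. *)
Lemma polytabloid_symz_neq0 : e t *m symz M row != 0.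
Proof.
apply/eqP => /rowP/(_ (enum_rank t0)); rewrite /symz mulmx_sumr summxE mxE.
rewrite (eq_bigr (fun=> 1)) => [|s]; last exact: polytabloid_row_coef.
apply/eqP; rewrite sumr_const natr_eq0 -lt0n.
by apply/card_gt0P; exists 1%g; exact: group1.
Qed.

(** If two elements of a column of [t] share a row of the tabloid [f], their transposition shows
    that [f] is annihilated. Otherwise a column permutation sorts [f], and as the row lengths agree
    the result is the tabloid of [t]. *)
Lemma antisymz_line p (v : 'M_(p, _)) : (v *m antisymz M col setT <= e t)%MS.
Proof.
apply: submx_trans (submxMl v _) _; apply/row_subP => i; rewrite rowE.
have -> : delta_mx 0 i = tab_delta (enum_val i) by rewrite /tab_delta enum_valK.
move: (enum_val i) => f {i p v}.
have [/existsP[x /existsP[z /and3P[nxz /eqP cxz /eqP fxz]]] | none] :=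
  boolP [exists x, exists z, [&& x != z, col x == col z & val f x == val f z]].
  have -> : tab_delta f *m antisymz M col setT = 0; last by rewrite sub0mx.
  have fE : tab_delta f *m M (tperm x z) = tab_delta f.
    rewrite tab_delta_act; congr tab_delta; apply/val_inj/ffunP => u.
    by rewrite ffunE tpermV; case: tpermP => // ->.
  have : tab_delta f *m antisymz M col setT = - (tab_delta f *m antisymz M col setT).
    rewrite -{1}fE -mulmxA Mantisymz ?tperm_col_group ?inE // odd_tperm nxz.
    by rewrite scaleN1r mulmxN.
  move/eqP; rewrite -subr_eq0 opprK -mulr2n -scaler_nat scaler_eq0.
  by rewrite natr_eq0 => /eqP.
have f_col x z : x != z -> col x = col z -> val f x != val f z.
  move=> nxz cxz; apply: contra none => fxz.
  by apply/existsP; exists x; apply/existsP; exists z; rewrite nxz cxz eqxx.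
pose fn x : nat := val f x.
have [g gC gs] := @exists_sorting_perm T (col_group_group col setT) fn row.
have /col_groupP gcol := gC.
have g_inc x z : col x = col z -> (row x < row z)%N -> (fn (g x) < fn (g z))%N.
  move=> cxz rxz; have nxz : x != z by apply: contraTneq rxz => ->; rewrite ltnn.
  rewrite ltn_neqAle (gs _ _ (tperm x z)) ?tperm_col_group ?inE // andbT.
  rewrite /fn (inj_eq val_inj) f_col ?(inj_eq perm_inj) //.
  by rewrite (gcol x).1 (gcol z).1.
have card_fn a : #|[set x | fn (g x) == a]| = #|[set x | row x == a]|.
  by rewrite (card_comp_perm fn) (card_tabloid f) (card_tab_row la_part t_tab).
have fnE x : fn (g x) = row x.
  apply/eqP; rewrite (sorted_lex (tableau_down la_part t_tab) g_inc (K := (row x).+1)) //.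
  by move=> a _ _; rewrite card_fn.
have -> : tab_delta f = tab_delta t0 *m M g.
  rewrite tab_delta_act; congr tab_delta; apply/val_inj/ffunP => x; rewrite !ffunE.
  by apply: val_inj => /=; rewrite -[RHS]/(row _) -fnE permKV.
by rewrite -mulmxA Mantisymz // -scalemxAr -polytabloid_antisymz scalemx_sub.
Qed.

Lemma module_antisymz p (V : 'M_(p, _)) q (u : 'M_(q, _)) :
  mxmodule M V -> (u <= V)%MS -> (u *m antisymz M col setT <= V)%MS.
Proof.
move=> Vmod uV; rewrite mulmx_sumr summx_sub // => s _.
by rewrite -scalemxAr scalemx_sub // mxmodule_trans ?inE.
Qed.

Lemma polytabloid_antisymz2 : e t *m antisymz M col setT = #|col_stab t|%:R *: e t.
Proof.
rewrite polytabloid_antisymz -mulmxA {1}/antisymz mulmx_suml col_stabE.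
rewrite (eq_bigr (fun=> antisymz M col setT)) => [|g gC].
  by rewrite sumr_const -scaler_nat -scalemxAr.
by rewrite -scalemxAl Mantisymz // scalerA -signr_addb addbb scale1r.
Qed.

(** By Maschke, a nonzero submodule V has a complement W in S. The antisymmetrizer multiplies the
    polytabloid by a nonzero scalar and sends its V-component into the line it spans. Hence V or W
    contains the polytabloid, which generates S; W cannot, as V is nonzero. *)
Lemma specht_simple : mxsimple M S.
Proof.
have e0 : e t != 0.
  by apply/eqP => /rowP/(_ (enum_rank t0)); rewrite polytabloid_coef // mxE => /eqP; rewrite oner_eq0.
split; first exact: specht_module.
  by apply: contra_neq e0 => S0; apply/eqP; rewrite -submx0 -S0 polytabloid_specht.
move=> V Vmod VS V0; apply: specht_generated => //.
have redS := mx_reducibleS (specht_module K T la) (submx1 _)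
  (mx_Maschke_pchar M (pchar0_pgroup _)).
have [W Wmod defS /mxdirect_addsP dxVW] := redS V Vmod VS.
have eVW : (e t <= V + W)%MS by rewrite defS polytabloid_specht.
have [[a b] /= eab] := sub_addsmxP eVW.
have Ce0 : #|col_stab t|%:R != 0 :> K.
  by rewrite natr_eq0 -lt0n col_stabE; apply/card_gt0P; exists 1%g; exact: group1.
have [aV0 | aV0] := eqVneq (a *m V *m antisymz M col setT) 0.
  suff eW : (e t <= W)%MS.
    case/eqP: V0; apply/eqP; rewrite -submx0 -dxVW sub_capmx submx_refl.
    by rewrite (submx_trans VS) // specht_generated.
  rewrite -(eqmx_scale _ Ce0) -polytabloid_antisymz2 eab mulmxDl aV0 add0r.
  by apply: module_antisymz; rewrite ?submxMl.
have /sub_rVP[c Ec] := antisymz_line (a *m V).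
have c0 : c != 0 by apply: contraNneq aV0 => c0; rewrite Ec c0 scale0r.
by rewrite -(eqmx_scale _ c0) -Ec; apply: module_antisymz; rewrite ?submxMl.
Qed.

End SpechtModule.

Section ColumnSwap.

Variables (T : finType) (la : seq nat).
Hypothesis la_part : is_partition #|T| la.
Variable t : {ffun T -> position la}.
Hypothesis t_tab : is_tableau t.

Definition swap_nat (c1 c2 c : nat) := if c == c1 then c2 else if c == c2 then c1 else c.

Lemma swap_nat_inj c1 c2 : injective (swap_nat c1 c2).
Proof. by move=> a b; rewrite /swap_nat; do !case: eqP => //; congruence. Qed.

(** Columns that reach the last row have full length, so exchanging two of them maps boxes to
    boxes. *)
Lemma exists_column_swap c1 c2 :
  c1 < nth 0 la (size la).-1 -> c2 < nth 0 la (size la).-1 ->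
  exists s : {perm T}, forall x,
    tab_row t (s x) = tab_row t x /\ tab_col t (s x) = swap_nat c1 c2 (tab_col t x).
Proof.
move=> l1 l2.
have H x : exists z, (tab_row t z == tab_row t x) && (tab_col t z == swap_nat c1 c2 (tab_col t x)).
  have rx : tab_row t x <= (size la).-1 by rewrite -ltnS (ltn_predK (ltn_ord (t x).1)); exact: ltn_ord.
  have lx : swap_nat c1 c2 (tab_col t x) < nth 0 la (tab_row t x).
    have := partition_nth_mono la_part rx; have := tableau_box t_tab x.
    by rewrite /swap_nat; do !case: eqP => //; lia.
  by have [z [rz cz]] := tableau_onto_nat la_part t_tab lx; exists z; rewrite rz cz !eqxx.
pose g x := xchoose (H x).
have gP x : tab_row t (g x) = tab_row t x /\ tab_col t (g x) = swap_nat c1 c2 (tab_col t x).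
  by have /andP[/eqP ? /eqP ?] := xchooseP (H x).
have g_inj : injective g.
  move=> x z E; apply: (tab_row_col_inj t_tab).
    by apply: (@swap_nat_inj c1 c2); rewrite -(gP x).2 E (gP z).2.
  by rewrite -(gP x).1 E (gP z).1.
by exists (perm g_inj) => x; rewrite permE.
Qed.

End ColumnSwap.

Section SpechtVector.
Local Open Scope ring_scope.

Variables (K : fieldType) (T : finType) (la : seq nat).
Hypothesis charK : [pchar K] =i pred0.
Hypothesis la_part : is_partition #|T| la.
Variable t : {ffun T -> position la}.
Hypothesis t_tab : is_tableau t.

Local Notation M := (tabloid_repr K T la).
Local Notation e := (polytabloid K t).
Local Notation S := (specht_mx K T la).
Local Notation rS := (specht_repr K T la).

Definition specht_vec : 'rV[K]_(\rank S) := in_submod S e.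

Lemma specht_vec_generated (U : 'M_(\rank S)) :
  mxmodule rS U -> (specht_vec <= U)%MS -> (1%:M <= U)%MS.
Proof.
move=> Umod eU; rewrite -(val_submodS (U := S)) (val_submod1 S).
apply: (specht_generated la_part t_tab); first by rewrite (val_submod_module (specht_module K T la)).
by rewrite -(in_submodK (polytabloid_specht K t_tab)) val_submodS.
Qed.

Lemma specht_vec_act g : specht_vec *m rS g = in_submod S (polytabloid K (tableau_act t g)).
Proof. by rewrite -polytabloid_act (in_submodJ (specht_module K T la)) ?polytabloid_specht. Qed.

Lemma specht_vec_col (g : {perm T}) : (forall x, tab_col t (g x) = tab_col t x) ->
  specht_vec *m rS g = (-1) ^+ g *: specht_vec.
Proof.
move=> gc; rewrite specht_vec_act polytabloid_col ?linearZ //.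
by rewrite inE; apply/forallP => x; apply/eqP/val_inj/gc.
Qed.

Lemma specht_vec_swap (g : {perm T}) c1 c2 :
  (forall x, tab_row t (g x) = tab_row t x /\ tab_col t (g x) = swap_nat c1 c2 (tab_col t x)) ->
  specht_vec *m rS g = specht_vec.
Proof.
move=> gP; rewrite specht_vec_act polytabloid_swap // => [x | x z].
  exact/val_inj/(gP x).1.
by rewrite -!val_eqE /= -!/(tab_col t _) !(gP _).2 (inj_eq (@swap_nat_inj _ _)).
Qed.

(** The functional is the coefficient at the tabloid of [t]. *)
Lemma specht_vec_functional : exists psi : 'cV[K]_(\rank S),
  forall g, g \in color_stab (tab_row t) -> specht_vec *m rS g *m psi = 1%:M.
Proof.
exists (val_submod 1%:M *m delta_mx (enum_rank (tab_of la_part t_tab)) 0) => g gR.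
rewrite mulmxA -val_submodE val_submodJ // in_submodK ?polytabloid_specht //.
apply/rowP => j; rewrite ord1 -(polytabloid_row_coef K la_part t_tab gR).
by rewrite -colE mxE [RHS]mxE.
Qed.

Lemma specht_fixed_vec : exists2 w : 'rV[K]_(\rank S), w != 0 &
  {in color_stab (tab_row t), forall g, w *m rS g = w}.
Proof.
have eS : (e *m symz M (tab_row t) <= S)%MS.
  rewrite /symz mulmx_sumr summx_sub // => g _.
  by rewrite mxmodule_trans ?inE ?specht_module ?polytabloid_specht.
exists (in_submod S (e *m symz M (tab_row t))).
  by rewrite -(val_submod_eq0 (U := S)) in_submodK // polytabloid_symz_neq0.
by move=> g gR; rewrite -(in_submodJ (specht_module K T la)) // -mulmxA symzM.
Qed.

End SpechtVector.

(** * Induced modules and tensor powers *)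

Section InducedVectors.
Local Open Scope ring_scope.

Variables (K : fieldType) (gT : finGroupType) (G H : {group gT}).
Hypothesis sHG : H \subset G.
Variables (d : nat) (rH : mx_representation K H d).

Local Notation rI := (ind_repr rH sHG).

Lemma unit_coset_subproof : (H : {set gT}) \in rcosets H G.
Proof. by apply/rcosetsP; exists 1%g; rewrite ?group1 ?rcoset1. Qed.

Definition unit_coset : coset_in G H :=
  exist (fun C : {set gT} => C \in rcosets H G) _ unit_coset_subproof.

(** This is the vector u (x) 1 of the induced module. *)
Definition ind_emb (u : 'rV[K]_d) : 'rV[K]_#|ind_idx G H d| :=
  \row_j (if (enum_val j).1 == unit_coset then u 0 (enum_val j).2 else 0).

Definition ind_proj (C : coset_in G H) (w : 'rV[K]_#|ind_idx G H d|) : 'rV[K]_d :=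
  \row_a w 0 (enum_rank ((C, a) : ind_idx G H d)).

Lemma ind_proj_inj (w w' : 'rV[K]_#|ind_idx G H d|) :
  (forall C, ind_proj C w = ind_proj C w') -> w = w'.
Proof.
move=> E; apply/rowP => j; rewrite -(enum_valK j); case: (enum_val j) => C a.
by have /rowP/(_ a) := E C; rewrite !mxE.
Qed.

Lemma ind_proj_sum C (I : finType) (P : pred I) (w : I -> 'rV[K]_#|ind_idx G H d|) :
  ind_proj C (\sum_(i | P i) w i) = \sum_(i | P i) ind_proj C (w i).
Proof.
by apply/rowP => a; rewrite !mxE !summxE; apply: eq_bigr => i _; rewrite !mxE.
Qed.

Lemma ind_proj0 C : ind_proj C 0 = 0.
Proof. by apply/rowP => a; rewrite !mxE. Qed.

Lemma ind_proj_emb C u : ind_proj C (ind_emb u) = if C == unit_coset then u else 0.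
Proof. by apply/rowP => a; rewrite !mxE enum_rankK /=; case: ifP; rewrite ?mxE. Qed.

Lemma ind_proj_act C u g :
  ind_proj C (ind_emb u *m rI g) =
    if (g * (repr (val C))^-1)%g \in H then u *m rH (g * (repr (val C))^-1)%g else 0.
Proof.
apply/rowP => b; rewrite !mxE.
rewrite (reindex (@enum_rank (ind_idx G H d))) /=; last by apply: onW_bij; exact: enum_rank_bij.
rewrite (eq_bigr (fun k : ind_idx G H d =>
   (if k.1 == unit_coset then u 0 k.2 else 0) * ind_entry rH g k (C, b))); last first.
  by move=> k _; rewrite !mxE !enum_rankK.
rewrite -(pair_bigA _ (fun D a =>
   (if D == unit_coset then u 0 a else 0) * ind_entry rH g (D, a) (C, b))) /=.
rewrite (bigD1 unit_coset) //= [X in _ + X]big1 ?addr0; last first.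
  by move=> D /negPf->; rewrite big1 // => a _; rewrite mul0r.
(* The representative chosen by [repr] in the coset [H] is 1. *)
rewrite eqxx /ind_entry /= repr_group mul1g.
case: ifP => Hg; first by rewrite mxE.
by rewrite mxE big1 // => a _; rewrite mulr0.
Qed.

Lemma unit_coset_eq C : (((repr (val C))^-1)%g \in H) = (C == unit_coset).
Proof. by rewrite eq_sym -(coset_in_eq sHG) /= repr_group mul1g. Qed.

Lemma ind_emb_act u h : h \in H -> ind_emb u *m rI h = ind_emb (u *m rH h).
Proof.
move=> Hh; apply: ind_proj_inj => C; rewrite ind_proj_act ind_proj_emb.
rewrite groupMl // unit_coset_eq; case: eqP => // ->.
by rewrite /= repr_group invg1 mulg1.
Qed.

(** The basis vector at the coset C is the translate, by the representative of C, of a basis vector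
    at the unit coset. *)
Lemma ind_generated p (U : 'M[K]_(p, _)) :
  mxmodule rI U -> (forall u, ind_emb u <= U)%MS -> (1%:M <= U)%MS.
Proof.
move=> Umod UE; apply/row_subP => j; rewrite row1 -(enum_valK j).
case: (enum_val j) => C a; have [GC _] := repr_coset_in sHG C.
suff -> : delta_mx 0 (enum_rank ((C, a) : ind_idx G H d)) =
          ind_emb (delta_mx 0 a) *m rI (repr (val C)).
  by rewrite mxmodule_trans.
apply: ind_proj_inj => D; rewrite ind_proj_act (coset_in_eq sHG).
apply/rowP => b; rewrite !mxE (inj_eq enum_rank_inj) xpair_eqE eqxx /= eq_sym.
case: eqP => [-> | _]; last by rewrite mxE.
by rewrite mulgV repr_mx1 mulmx1 mxE eqxx.
Qed.

End InducedVectors.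

(** * Tensor products of row vectors *)

Section RowTensor.
Local Open Scope ring_scope.

Variable K : fieldType.

Lemma tprod_row d1 d2 (x : 'rV[K]_d1) (y : 'rV[K]_d2) :
  tprod x y = col_mx (trow x y) (tprod (dsubmx (x : 'M_(1 + 0, d1))) y).
Proof.
rewrite /=; have -> // : usubmx (x : 'M_(1 + 0, d1)) = x.
by apply/rowP => j; rewrite mxE; congr (x _ _); apply: val_inj.
Qed.

(** By [tprod_row], this is the first row block of the multiplicativity of [tprod]. *)
Lemma trow_tprod d1 d2 e1 e2 (x : 'rV[K]_d1) (y : 'rV[K]_d2)
    (A : 'M_(d1, e1)) (B : 'M_(d2, e2)) :
  trow (x *m A) (y *m B) = trow x y *m tprod A B.
Proof.
have := tprodE x A y B; rewrite (tprod_row x) (tprod_row (x *m A)).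
move=> E; have := etrans E (@mul_col_mx _ 1 0 (d1 * d2) (e1 * e2) (trow x y) _ _).
by move/eq_col_mx => [].
Qed.

Lemma trowZ d1 d2 (x : 'rV[K]_d1) (y : 'rV[K]_d2) a b :
  trow (a *: x) (b *: y) = (a * b) *: trow x y.
Proof. by rewrite -trowbE linearZ /= trowbE linearZ scalerA. Qed.

Lemma trow11 (x y : 'rV[K]_1) : trow x y 0 0 = x 0 0 * y 0 0.
Proof.
have lE : lsubmx (x : 'M_(1, 1 + 0)) 0 0 = x 0 0.
  by rewrite mxE; congr (x _ _); apply: val_inj.
rewrite /= lE [X in row_mx _ X]thinmx0 /=.
by rewrite mxE; case: splitP => [j _ | [] //]; rewrite mxE (ord1 j).
Qed.

(** The induction on [d1] follows the recursion of [trow], which splits off one block of length [d2]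
    for each coordinate of [x]. *)
Lemma trow_span d1 d2 p (U : 'M[K]_(p, d1 * d2)) :
  (forall (x : 'rV_d1) (y : 'rV_d2), (trow x y <= U)%MS) -> (1%:M <= U)%MS.
Proof.
move=> UE; suff {UE} H (v : 'rV[K]_(d1 * d2)) : 
    exists y : 'I_d1 -> 'rV[K]_d2, v = \sum_i trow (delta_mx 0 i) (y i).
  by apply/row_subP => j; have [y ->] := H (row j 1%:M); rewrite summx_sub.
move: v {p U}; elim: d1 => [|d1 IH] v.
  by exists (fun=> 0); rewrite big_ord0; apply/rowP => -[].
have [y yE] := IH (rsubmx (v : 'M_(1, d2 + d1 * d2))).
pose y' (i : 'I_d1.+1) :=
  if unlift ord0 i is Some j then y j else lsubmx (v : 'M_(1, d2 + d1 * d2)).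
exists y'; rewrite -[LHS](@hsubmxK _ 1 d2 (d1 * d2)) yE.
have row0 : trow (delta_mx 0 ord0 : 'rV[K]_d1.+1) (y' ord0) =
            row_mx (lsubmx (v : 'M_(1, d2 + d1 * d2))) 0.
  rewrite /y' unlift_none /=; congr row_mx.
    by rewrite !mxE scale1r.
  rewrite (_ : rsubmx _ = 0) -?trowbE ?linear0 //.
  by apply/rowP => j; rewrite !mxE.
have rowS i : trow (delta_mx 0 (lift ord0 i) : 'rV[K]_d1.+1) (y' (lift ord0 i)) =
              row_mx 0 (trow (delta_mx 0 i) (y i)).
  rewrite /y' liftK /=; congr row_mx.
    by rewrite !mxE scale0r.
  rewrite (_ : rsubmx _ = delta_mx 0 i) //; apply/rowP => j; rewrite !mxE.
  by rewrite -(inj_eq (@lift_inj _ ord0)); congr (_ && (_ == _))%:R; apply: val_inj.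
rewrite big_ord_recl row0 (eq_bigr _ (fun i _ => rowS i)).
have <- : row_mx (0 : 'rV_d2) (\sum_i trow (delta_mx 0 i) (y i)) =
          \sum_i row_mx (0 : 'rV_d2) (trow (delta_mx 0 i) (y i)).
  apply: (big_morph (fun X : 'rV_(d1 * d2) => row_mx (0 : 'rV_d2) X)) => [X Y|].
    by rewrite add_row_mx addr0.
  by rewrite row_mx0.
by rewrite add_row_mx addr0 add0r.
Qed.

End RowTensor.

(** * Pure tensors in the wreath product module *)

Section WreathVectors.
Local Open Scope ring_scope.

Variables (m n : nat).
Hypothesis m_gt0 : (0 < m)%N.
Variables (K : fieldType) (d e : nat).
Variables (rW : mx_representation K [set: {perm 'I_m}] d)
  (rZ : mx_representation K [set: {perm 'I_n}] e).

Local Notation rV := (oslash_repr m_gt0 rW rZ).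

Local Notation pidx j := (enum_val j : {ffun 'I_n -> 'I_d}).

Definition pten (w : 'I_n -> 'rV[K]_d) : 'rV[K]_#|pow_idx n d| :=
  \row_j \prod_i w i 0 (pidx j i).

Lemma eq_pten w w' : w =1 w' -> pten w = pten w'.
Proof. by move=> E; apply/rowP => j; rewrite !mxE; apply: eq_bigr => i _; rewrite E. Qed.

Lemma ptenZ (c : 'I_n -> K) w : pten (fun i => c i *: w i) = (\prod_i c i) *: pten w.
Proof.
apply/rowP => j; rewrite !mxE -big_split /=.
by apply: eq_bigr => i _; rewrite mxE.
Qed.

Lemma pten_mulmx p (w : 'I_n -> 'rV[K]_d) (A : 'I_n -> 'I_d -> 'I_p -> K)
    (g : {ffun 'I_n -> 'I_p}) :
  \sum_(f : {ffun 'I_n -> 'I_d}) (\prod_i w i 0 (f i)) * (\prod_i A i (f i) (g i)) =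
  \prod_i \sum_c w i 0 c * A i c (g i).
Proof. by rewrite bigA_distr_bigA /=; apply: eq_bigr => f _; rewrite big_split. Qed.

Lemma sum_enum_val (I : finType) (F : I -> K) : \sum_(i < #|I|) F (enum_val i) = \sum_i F i.
Proof.
rewrite (reindex (@enum_rank I)) /=; last by apply: onW_bij; exact: enum_rank_bij.
by apply: eq_bigr => i _; rewrite enum_rankK.
Qed.

Lemma pten_act w a t :
  pten w *m pow_repr n m_gt0 rW (wr_perm (a, t)) =
    pten (fun i => w (t^-1%g i) *m rW (a (t^-1%g i))).
Proof.
apply/rowP => j; rewrite !mxE /= /pow_mx wr_permK //.
pose G (f : pow_idx n d) := (\prod_i w i 0 (f i)) * (\prod_i rW (a i) (f i) (pidx j (t i))).
rewrite (eq_bigr (fun k => G (enum_val k))); last by move=> k _; rewrite !mxE.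
rewrite (sum_enum_val G).
have := pten_mulmx w (fun i c c' => rW (a i) c c') [ffun i => pidx j (t i)].
rewrite (eq_bigr G); last first.
  by move=> f _; congr (_ * _); apply: eq_bigr => i _; rewrite ffunE.
move=> ->; rewrite [RHS](reindex_inj (@perm_inj _ t)) /=.
by apply: eq_bigr => i _; rewrite permK mxE; apply: eq_bigr => c _; rewrite ffunE.
Qed.

Lemma pten_functional w (psi : 'cV[K]_d) :
  pten w *m (\col_j \prod_i psi (pidx j i) 0) = (\prod_i (w i *m psi) 0 0)%:M.
Proof.
apply/rowP => j; rewrite ord1 !mxE mulr1n.
pose G (f : pow_idx n d) := (\prod_i w i 0 (f i)) * (\prod_i psi (f i) 0).
rewrite (eq_bigr (fun k => G (enum_val k))); last by move=> k _; rewrite !mxE.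
rewrite (sum_enum_val G).
have := pten_mulmx w (fun i c (c' : 'I_1) => psi c 0) [ffun=> 0] => ->.
by apply: eq_bigr => i _; rewrite mxE.
Qed.

Lemma oslash_act w (y : 'rV_e) a t :
  trow (pten w) y *m rV (wr_perm (a, t)) =
    trow (pten (fun i => w (t^-1%g i) *m rW (a (t^-1%g i)))) (y *m rZ t).
Proof.
by rewrite -pten_act trow_tprod /= /infl_mx wr_permK.
Qed.

Variables (u : 'rV[K]_d) (z : 'rV[K]_e).

Definition oslash_vec : 'rV[K]_(#|pow_idx n d| * e) := trow (pten (fun=> u)) z.

Lemma oslash_vec_sign (a : {ffun 'I_n -> {perm 'I_m}}) (t : {perm 'I_n}) (eps : 'I_n -> K) del :
  (forall i, u *m rW (a i) = eps i *: u) -> z *m rZ t = del *: z ->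
  oslash_vec *m rV (wr_perm (a, t)) = ((\prod_i eps i) * del) *: oslash_vec.
Proof.
move=> uE zE; rewrite /oslash_vec oslash_act zE.
rewrite (@eq_pten _ (fun i => eps (t^-1%g i) *: u)); last by move=> i; rewrite uE.
rewrite ptenZ trowZ; congr (_ * _ *: _).
by rewrite [LHS](reindex_inj (@perm_inj _ t)); apply: eq_bigr => i _; rewrite permK.
Qed.

Lemma cyclic_span (gT : finGroupType) (G : {group gT}) p (rX : mx_representation K G p)
    (x : 'rV[K]_p) :
  (forall U : 'M_p, mxmodule rX U -> (x <= U)%MS -> (1%:M <= U)%MS) ->
  forall v : 'rV_p, exists c : gT -> K, v = \sum_(g in G) c g *: (x *m rX g).
Proof.
move=> gen v; have := gen _ (cyclic_mx_module rX x) (cyclic_mx_id rX x).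
move/(submx_trans (submx1 v))/cyclic_mxP => [A /envelop_mxP[c ->] ->].
by exists c; rewrite mulmx_sumr; apply: eq_bigr => g _; rewrite scalemxAr.
Qed.

Hypothesis u_gen : forall U : 'M_d, mxmodule rW U -> (u <= U)%MS -> (1%:M <= U)%MS.
Hypothesis z_gen : forall U : 'M_e, mxmodule rZ U -> (z <= U)%MS -> (1%:M <= U)%MS.

(** Pure tensors reduce to translates of [oslash_vec] in three expansions: the second factor in the
    translates of [z], the first in basis tensors, and each basis tensor multilinearly in the
    translates of [u]. *)
Lemma oslash_generated p (U : 'M[K]_(p, _)) :
  mxmodule rV U -> (oslash_vec <= U)%MS -> (1%:M <= U)%MS.
Proof.
move=> Umod eU; apply: trow_span => x y.
have [b ->] := cyclic_span z_gen y.
rewrite linear_sum summx_sub // => t _; rewrite linearZ scalemx_sub //= {y b}.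
rewrite -trowbE [x]row_sum_delta linear_sum summx_sub // => j _; rewrite linearZ scalemx_sub //= trowbE.
have c_ex i : {c : {ffun {perm 'I_m} -> K} | delta_mx 0 i == \sum_g c g *: (u *m rW g)}.
  apply: sigW; have [c cE] := cyclic_span u_gen (delta_mx 0 i : 'rV_d).
  exists [ffun g => c g]; rewrite cE; apply/eqP; apply: eq_big => [g | g _]; first by rewrite inE.
  by rewrite ffunE.
pose c i := sval (c_ex i).
have cE i : delta_mx 0 i = \sum_g c i g *: (u *m rW g) := eqP (svalP (c_ex i)).
have -> : delta_mx 0 j = \sum_(a : {ffun 'I_n -> {perm 'I_m}})
    (\prod_i c (pidx j i) (a i)) *: pten (fun i => u *m rW (a i)).
  apply/rowP => l; rewrite mxE eqxx /= summxE.
  rewrite (eq_bigr (fun a : {ffun 'I_n -> {perm 'I_m}} =>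
    \prod_i (c (pidx j i) (a i) * (u *m rW (a i)) 0 (pidx l i)))); last first.
    by move=> a _; rewrite !mxE -big_split.
  rewrite -(bigA_distr_bigA (fun i g => c (pidx j i) g * (u *m rW g) 0 (pidx l i))) /=.
  rewrite (eq_bigr (fun i => (pidx j i == pidx l i)%:R)).
    have [-> | ne] := eqVneq l j; first by rewrite big1 // => i _; rewrite eqxx.
    have [i ne_i] : exists i, pidx j i != pidx l i.
      apply/existsP; apply: contraNT ne; rewrite negb_exists => /forallP E.
      by apply/eqP/enum_val_inj/ffunP => i; apply/eqP; rewrite eq_sym -[_ == _]negbK.
    by rewrite (bigD1 i) //= (negPf ne_i) mul0r.
  move=> i _; transitivity ((delta_mx 0 (pidx j i) : 'rV[K]_d) 0 (pidx l i)).
    by rewrite cE summxE; apply: eq_bigr => g _; rewrite [RHS]mxE.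
  by rewrite mxE eqxx /= eq_sym.
rewrite -trowbE linear_sum summx_sub // => a _; rewrite linearZ scalemx_sub //= trowbE.
(* The factor at position [t i] comes from position [i], hence the reindexing of [a] by [t]. *)
have -> : trow (pten (fun i => u *m rW (a i))) (z *m rZ t) =
   oslash_vec *m rV (wr_perm ([ffun i => a (t i)], t)).
  rewrite oslash_act [in RHS](@eq_pten _ (fun i => u *m rW (a i))) // => i.
  by rewrite ffunE permKV.
by rewrite mxmodule_trans //; apply/imsetP; exists ([ffun i => a (t i)], t).
Qed.

Variables (psi : 'cV[K]_d) (phi : 'cV[K]_e).

Definition oslash_functional : 'cV[K]_(#|pow_idx n d| * e) :=
  tprod (\col_j \prod_i psi (pidx j i) 0) phi.

Lemma oslash_functionalE (a : {ffun 'I_n -> {perm 'I_m}}) (t : {perm 'I_n}) :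
  (forall i, u *m rW (a i) *m psi = 1%:M) -> z *m rZ t *m phi = 1%:M ->
  oslash_vec *m rV (wr_perm (a, t)) *m oslash_functional = 1%:M.
Proof.
move=> uE zE; rewrite /oslash_vec oslash_act.
rewrite -[LHS](trow_tprod _ _ (\col_j \prod_i psi (pidx j i) 0) phi) pten_functional zE.
rewrite big1 => [|i _]; last by rewrite uE mxE.
by apply/rowP => j; rewrite ord1 trow11 !mxE mulr1.
Qed.

End WreathVectors.

Section LineStabilizer.
Local Open Scope ring_scope.

Variables (K : fieldType) (T : finType) (d : nat).
Hypothesis charK : [pchar K] =i pred0.
Variables (X : mx_representation K [set: {perm T}] d) (e : 'rV[K]_d).

(** For [g] in this group, e a_F equals e a_{F g} g up to sign, so colourings may be sorted along
    it. *)
Definition line_stab : {set {perm T}} :=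
  [set g : {perm T} | (e *m X g == e) || (e *m X g == - e)].

Lemma line_stab_group_set : group_set line_stab.
Proof.
apply/group_setP; split; first by rewrite inE repr_mx1 mulmx1 eqxx.
move=> g h; rewrite !inE repr_mxM ?inE // mulmxA.
by case/orP => /eqP-> /orP[] /eqP; rewrite ?mulNmx => ->; rewrite ?opprK eqxx ?orbT.
Qed.
Canonical line_stab_group := group line_stab_group_set.

Lemma line_stabP g : reflect (exists b : bool, e *m X g = (-1) ^+ b *: e) (g \in line_stab).
Proof.
rewrite inE; apply: (iffP orP) => [[/eqP-> | /eqP->] | [[] ->]].
- by exists false; rewrite scale1r.
- by exists true; rewrite scaleN1r.
- by right; rewrite scaleN1r.
by left; rewrite scale1r.
Qed.

(** Absorbing [h] gives e a_F = e h a_F = - e a_F. *)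
Lemma symz_opp_eq0 (F : T -> nat) h : h \in color_stab F -> e *m X h = - e ->
  e *m symz X F = 0.
Proof.
move=> hF eh; have : e *m symz X F = - (e *m symz X F).
  by rewrite -{1}(Msymz X hF) mulmxA eh mulNmx.
move/eqP; rewrite -subr_eq0 opprK -mulr2n -scaler_nat scaler_eq0.
by rewrite (natr_eq0 charK) => /eqP.
Qed.

End LineStabilizer.

(** * Colourings whose symmetrizer does not annihilate the generator *)

Section MarkedVector.
Local Open Scope ring_scope.

Variables (m n : nat) (mu nu : seq nat).
Hypotheses (mu_part : is_partition #|'I_m| mu) (nu_part : is_partition #|'I_n| nu).
Variable K : fieldType.
Hypothesis charK : [pchar K] =i pred0.

Variables (t : {ffun 'I_m -> position mu}) (s : {ffun 'I_n -> position nu}).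
Hypotheses (t_tab : is_tableau t) (s_tab : is_tableau s).

Local Notation rt := (tab_row t).
Local Notation ct := (tab_col t).
Local Notation rs := (tab_row s).
Local Notation cs := (tab_col s).
Local Notation T := ('I_n * 'I_m)%type.

Variables (d : nat) (X : mx_representation K [set: {perm T}] d) (e : 'rV[K]_d).

Hypothesis e_col : forall i x z, x != z -> ct x = ct z -> e *m X (tperm (i, x) (i, z)) = - e.
Hypothesis e_swap : forall i (g : {perm 'I_m}) c1 c2,
  (forall x, rt (g x) = rt x /\ ct (g x) = swap_nat c1 c2 (ct x)) ->
  e *m X (wr_perm ([ffun j => if j == i then g else 1%g], 1%g)) = e.
Hypothesis e_transpose : forall i j, i != j -> cs i = cs j ->
  e *m X (wr_perm ([ffun=> 1%g], tperm i j)) = - e.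

Variable y : 'I_m.
Local Notation k := (size mu).-1.
Hypothesis rt_y : rt y = k.

Lemma tab_row_le_last x : (rt x <= k)%N.
Proof. by rewrite -ltnS (ltn_predK (ltn_ord (t x).1)); exact: ltn_ord. Qed.

Local Notation F0 := (marked_coloring rt k y rs).

(** After sorting [F] along [line_stab], no element negating [e] stabilizes the colouring. For
    transpositions within a column of a copy of t, and of two copies in a column of s, this gives
    the distinctness hypotheses of [core_marked]. *)
Lemma marked_of_symz_neq0 (F : T -> nat) :
  e *m symz X F != 0 ->
  (forall a, (forall b, (b < a)%N -> #|[set p | F p == b]| = #|[set p | F0 p == b]|) ->
     (#|[set p | F0 p == a]| <= #|[set p | F p == a]|)%N) ->
  exists2 g, g \in line_stab X e & forall p, F (g p) = F0 p.
Proof.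
move=> eF F_lex.
(* The weight grows with the row of t; marks outweigh all other boxes and are ordered among
   themselves by the rows of s. *)
pose w (p : T) := (rt p.2 + (p.2 == y) * (rs p.1).+1)%N.
have [g gN g_sorted] := exists_sorting_perm (line_stab_group X e) F w.
exists g => //.
have eFg : e *m symz X (F \o g) != 0.
  apply: contraNneq eF => eFg0; have [b bE] := line_stabP X e g gN.
  have : e *m X g *m symz X F = 0 by rewrite -mulmxA symz_comp mulmxA eFg0 mul0mx.
  move/eqP; rewrite bE -scalemxAl scaler_eq0 => /orP[|//].
  by rewrite signr_eq0.
have not_opp h : e *m X h = - e -> exists p, F (g (h p)) != F (g p).
  move=> eh; apply/existsP; apply: contraR eFg; rewrite negb_exists => /forallP H.
  rewrite (symz_opp_eq0 charK _ eh) //; apply/color_stabP => p /=.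
  by apply/eqP; rewrite -[_ == _]negbK.
have opp_line h : e *m X h = - e -> h \in line_stab X e.
  by move=> eh; rewrite inE eh eqxx orbT.
have N_col i x z : x != z -> ct x = ct z -> tperm (i, x) (i, z) \in line_stab X e.
  by move=> nxz cxz; apply: opp_line; exact: e_col.
have F_col i x z : x != z -> ct x = ct z -> F (g (i, x)) != F (g (i, z)).
  move=> nxz cxz; have [p] := not_opp _ (e_col i nxz cxz).
  by case: tpermP => [-> | -> | ]; rewrite ?eqxx // eq_sym.
have blockE i j p : wr_perm ([ffun=> 1%g], tperm i j) p = (tperm i j p.1, p.2).
  by rewrite permE /= /wr_fun /= ffunE perm1.
apply: (core_marked (tableau_down mu_part t_tab) (tableau_down nu_part s_tab) tab_row_le_last rt_y
  (N := line_stab X e) (F := F \o g)) => //=.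
- move=> i x rx.
  (* A box of the last row lies in a column of full length, as [exists_column_swap] requires. *)
  have l z : rt z = k -> (ct z < nth 0 mu k)%N by move=> <-; exact: tableau_box.
  have [h hP] := exists_column_swap mu_part t_tab (l x rx) (l y rt_y).
  exists (wr_perm ([ffun j => if j == i then h else 1%g], 1%g)).
  have hE j z : wr_perm ([ffun j => if j == i then h else 1%g], 1%g) (j, z) =
                (j, if j == i then h z else z).
    by rewrite permE /= /wr_fun /= ffunE perm1; case: ifP; rewrite ?perm1.
  split.
  + by rewrite inE (e_swap i hP) eqxx.
  + rewrite hE eqxx; congr (_, _); apply: (tab_row_col_inj t_tab).
      by rewrite (hP x).2 /swap_nat eqxx.
    by rewrite (hP x).1 rx rt_y.
  + rewrite hE eqxx; congr (_, _); apply: (tab_row_col_inj t_tab).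
      by rewrite (hP y).2 /swap_nat eqxx; case: eqP.
    by rewrite (hP y).1 rx rt_y.
  + by move=> [j z] /= /negPf ji; rewrite hE ji.
  move=> z zx zy; rewrite hE eqxx /=; split=> //; case: eqP => rz; last exact: (hP z).1.
  apply: (tab_row_col_inj t_tab); last exact: (hP z).1.
  rewrite (hP z).2 /swap_nat; case: eqP => [cz | _].
    by case/eqP: zx; apply: (tab_row_col_inj t_tab); rewrite ?rz ?rx.
  case: eqP => [cz | //].
  by case/eqP: zy; apply: (tab_row_col_inj t_tab); rewrite ?rz ?rt_y.
- move=> i j nij cij; exists (wr_perm ([ffun=> 1%g], tperm i j)) => [|p]; last exact: blockE.
  by apply: opp_line; exact: e_transpose.
- move=> i j nij cij; have [[l z]] := not_opp _ (e_transpose nij cij).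
  rewrite blockE /=; case: tpermP => [-> | -> | ]; rewrite ?eqxx // => ne; exists z => //.
  by rewrite eq_sym.
move=> a H; rewrite card_comp_perm; apply: F_lex => b ba.
by rewrite -(card_comp_perm F g) H.
Qed.

End MarkedVector.

Section InducedGenerator.
Local Open Scope ring_scope.

Variables (K : fieldType) (gT : finGroupType) (G H : {group gT}).
Hypothesis sHG : H \subset G.
Variables (d : nat) (rH : mx_representation K H d) (x : 'rV[K]_d).
Hypothesis x_gen : forall U : 'M_d, mxmodule rH U -> (x <= U)%MS -> (1%:M <= U)%MS.

Lemma ind_emb_mx : exists E : 'M[K]_(d, #|ind_idx G H d|), forall v : 'rV[K]_d, ind_emb G H v = v *m E.
Proof.
exists (\matrix_a ind_emb G H (delta_mx 0 a)) => v; apply/rowP => j.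
rewrite !mxE; case: ifP => C1.
  rewrite (bigD1 (enum_val j).2) //= !mxE C1 !eqxx mulr1 big1 ?addr0 // => a.
  by rewrite !mxE C1 eqxx /= eq_sym => /negPf->; rewrite mulr0.
by rewrite big1 // => a _; rewrite !mxE C1 mulr0.
Qed.

Lemma ind_embZ c (v : 'rV[K]_d) : ind_emb G H (c *: v) = c *: ind_emb G H v.
Proof. by have [E EE] := ind_emb_mx; rewrite !EE scalemxAl. Qed.

(** The vectors [u] with [ind_emb u] in [U] form a submodule for [H], written as the kernel [U']; it
    contains [x], hence is everything. *)
Lemma ind_emb_generated p (U : 'M[K]_(p, _)) :
  mxmodule (ind_repr rH sHG) U -> (ind_emb G H x <= U)%MS -> (1%:M <= U)%MS.
Proof.
move=> Umod xU; have [E EE] := ind_emb_mx.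
pose U' := kermx (E *m cokermx U).
have U'E (v : 'rV_d) : (v <= U')%MS = (ind_emb G H v <= U)%MS.
  by rewrite EE [RHS]submxE /U'; apply/sub_kermxP/eqP; rewrite mulmxA.
apply: (ind_generated (sHG := sHG) Umod) => u; rewrite -U'E.
apply: submx_trans (submx1 u) _; apply: x_gen; last by rewrite U'E.
apply/mxmoduleP => h Hh; apply/row_subP => i; rewrite row_mul U'E -ind_emb_act //.
by rewrite mxmodule_trans ?(subsetP sHG) // -U'E row_sub.
Qed.

End InducedGenerator.

(** * The generator of the generalized Foulkes module *)

Section Foulkes.
Local Open Scope ring_scope.

Variables (m n : nat).
Hypothesis m_gt0 : (0 < m)%N.
Variables (mu nu : seq nat).
Hypotheses (mu_part : is_partition #|'I_m| mu) (nu_part : is_partition #|'I_n| nu).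
Variable K : fieldType.
Hypothesis charK : [pchar K] =i pred0.

Variables (t : {ffun 'I_m -> position mu}) (s : {ffun 'I_n -> position nu}).
Hypotheses (t_tab : is_tableau t) (s_tab : is_tableau s).

Local Notation rt := (tab_row t).
Local Notation ct := (tab_col t).
Local Notation rs := (tab_row s).
Local Notation cs := (tab_col s).
Local Notation T := ('I_n * 'I_m)%type.

Definition foulkes_gen :=
  ind_repr (oslash_repr m_gt0 (specht_repr K 'I_m mu) (specht_repr K 'I_n nu))
    (subsetT (wreath_group m n)).

Local Notation X := foulkes_gen.

Definition foulkes_vec :=
  ind_emb [set: {perm 'I_n * 'I_m}] (wreath_group m n) (oslash_vec n (specht_vec K t) (specht_vec K s)).

Local Notation e := foulkes_vec.

Lemma foulkes_vec_generated p (U : 'M[K]_(p, _)) :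
  mxmodule X U -> (e <= U)%MS -> (1%:M <= U)%MS.
Proof.
apply: ind_emb_generated => U'; apply: oslash_generated => V.
  exact: specht_vec_generated.
exact: specht_vec_generated.
Qed.

Lemma wr_perm_wreath p : wr_perm p \in wreath m n.
Proof. by apply/imsetP; exists p. Qed.

Lemma foulkes_vec_act (a : {ffun 'I_n -> {perm 'I_m}}) (h : {perm 'I_n}) (eps : 'I_n -> K) del :
  (forall i, specht_vec K t *m specht_repr K 'I_m mu (a i) = eps i *: specht_vec K t) ->
  specht_vec K s *m specht_repr K 'I_n nu h = del *: specht_vec K s ->
  e *m X (wr_perm (a, h)) = ((\prod_i eps i) * del) *: e.
Proof.
move=> aE hE; rewrite ind_emb_act ?wr_perm_wreath //.
have -> := oslash_vec_sign m_gt0 aE hE.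
by rewrite ind_embZ.
Qed.

Lemma foulkes_vec_block i (g : {perm 'I_m}) c :
  specht_vec K t *m specht_repr K 'I_m mu g = c *: specht_vec K t ->
  e *m X (wr_perm ([ffun j => if j == i then g else 1%g], 1%g)) = c *: e.
Proof.
move=> gE; rewrite (@foulkes_vec_act _ _ (fun j => if j == i then c else 1) 1).
- rewrite (bigD1 i) //= eqxx big1 ?mulr1 // => j /negPf-> //.
- by move=> j; rewrite ffunE; case: ifP => // _; rewrite repr_mx1 mulmx1 scale1r.
by rewrite repr_mx1 mulmx1 scale1r.
Qed.

Lemma foulkes_vec_col i x z : x != z -> ct x = ct z -> e *m X (tperm (i, x) (i, z)) = - e.
Proof.
move=> nxz cxz; rewrite -scaleN1r.
have -> : tperm (i, x) (i, z) = wr_perm ([ffun j => if j == i then tperm x z else 1%g], 1%g).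
  apply/permP => -[j w]; rewrite [RHS]permE /= /wr_fun /= perm1 ffunE.
  case: (eqVneq j i) => [-> | ji]; last by rewrite perm1 tpermD // xpair_eqE eq_sym (negPf ji).
  have [-> | xw] := eqVneq w x; first by rewrite !tpermL.
  have [-> | zw] := eqVneq w z; first by rewrite !tpermR.
  by rewrite !tpermD ?xpair_eqE ?eqxx //= eq_sym.
apply: foulkes_vec_block; rewrite specht_vec_col //; last first.
  by move=> w; case: tpermP => [-> | -> | ].
by rewrite odd_tperm nxz.
Qed.

Lemma foulkes_vec_swap i (g : {perm 'I_m}) c1 c2 :
  (forall x, rt (g x) = rt x /\ ct (g x) = swap_nat c1 c2 (ct x)) ->
  e *m X (wr_perm ([ffun j => if j == i then g else 1%g], 1%g)) = e.
Proof.
move=> gP; rewrite (@foulkes_vec_block i g 1) ?scale1r //.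
exact: specht_vec_swap gP.
Qed.

Lemma foulkes_vec_transpose i j : i != j -> cs i = cs j ->
  e *m X (wr_perm ([ffun=> 1%g], tperm i j)) = - e.
Proof.
move=> nij cij; rewrite (@foulkes_vec_act _ _ (fun=> 1) (-1)).
- by rewrite big1 // mul1r scaleN1r.
- by move=> l; rewrite ffunE repr_mx1 mulmx1 scale1r.
rewrite specht_vec_col ?odd_tperm ?nij // => l.
by case: tpermP => [-> | -> |].
Qed.


Section MarkedInvariance.
Variables (k : nat) (y : 'I_m).
Hypotheses (rt_le : forall x, (rt x <= k)%N) (rt_y : rt y = k).
Local Notation F0 := (marked_coloring rt k y rs).

(** Colours above [k] occur only on marks, which lie in row [k]. *)
Lemma marked_minn p : minn (F0 p) k = rt p.2.
Proof.
rewrite /marked_coloring; case: eqP => [-> | _]; first by rewrite rt_y; apply/minn_idPr/leq_addr.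
exact/minn_idPl.
Qed.

Lemma sum_marked i : (\sum_x F0 (i, x) = \sum_(x | x != y) rt x + (k + rs i))%N.
Proof.
rewrite (bigD1 y) //= addnC {2}/marked_coloring /= eqxx; congr (_ + _)%N.
by apply: eq_bigr => x /negPf xy; rewrite /marked_coloring /= xy.
Qed.

(** Truncating colours at [k] shows that each [a i] preserves the rows of t. The colours of copy [i]
    add up to a constant plus [rs i], so [h] preserves the rows of s. *)
Lemma wr_color_stab a (h : {perm 'I_n}) : wr_perm (a, h) \in color_stab F0 ->
  (forall i, a i \in color_stab rt) /\ h \in color_stab rs.
Proof.
move=> /color_stabP H.
have {}H i x : F0 (h i, a i x) = F0 (i, x) by rewrite -(H (i, x)) permE.
split=> [i|]; apply/color_stabP => x.
  by rewrite -(marked_minn (h i, a i x)) H marked_minn.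
have := sum_marked (h x); rewrite (reindex_inj (@perm_inj _ (a x))) /=.
rewrite (eq_bigr (fun z => F0 (x, z))) => [|z _]; last by rewrite H.
by rewrite sum_marked => /addnI/addnI.
Qed.

(** In the component at the unit coset only the stabilizer elements in the wreath product
    contribute. The product of the two coefficient functionals is 1 on each contribution, so on the
    sum it is the number of these elements. *)
Lemma foulkes_symz_neq0 : e *m symz X F0 != 0.
Proof.
have [psi psiP] := specht_vec_functional K mu_part t_tab.
have [phi phiP] := specht_vec_functional K nu_part s_tab.
pose H := wreath_group m n; pose C := unit_coset [set: {perm T}] H.
pose rV := oslash_repr m_gt0 (specht_repr K 'I_m mu) (specht_repr K 'I_n nu).
pose ov := oslash_vec n (specht_vec K t) (specht_vec K s).
have projE g : ind_proj C (e *m X g) = if g \in H then ov *m rV g else 0.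
  by rewrite ind_proj_act /= repr_group invg1 mulg1.
apply/eqP => /(congr1 (ind_proj C)); rewrite /symz mulmx_sumr ind_proj_sum.
rewrite (eq_bigr _ (fun g _ => projE g)) -big_mkcondr /=.
rewrite ind_proj0.
move/(congr1 (fun w => w *m oslash_functional n psi phi)); rewrite mulmx_suml mul0mx.
rewrite (eq_bigr (fun=> 1%:M)) => [|g /andP[gF /imsetP[[a h] _ gE]]]; last first.
  move: gF; rewrite gE => /wr_color_stab[aR hR].
  by apply: (oslash_functionalE m_gt0) => [i|]; [exact: psiP | exact: phiP].
rewrite sumr_const => /rowP/(_ 0)/eqP; rewrite -scaler_nat !mxE mulr1 (natr_eq0 charK) -leqn0 leqNgt.
move/negP; apply; apply/card_gt0P; exists 1%g; rewrite unfold_in; apply/andP; split; exact: group1.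
Qed.

End MarkedInvariance.
End Foulkes.

(** * The highest constituent *)

Section SimpleImage.
Local Open Scope ring_scope.

Variables (K : fieldType) (gT : finGroupType) (G : {group gT}).
Variables (p : nat) (rS : mx_representation K G p) (q : nat) (rX : mx_representation K G q).

Lemma submod_iso_fixed (D : {set gT}) (U : 'M[K]_q) (w : 'rV[K]_p) :
  D \subset G -> submod_iso rX rS U -> w != 0 -> {in D, forall g, w *m rS g = w} ->
  exists w' : 'rV[K]_q, [/\ w' != 0, (w' <= U)%MS & {in D, forall g, w' *m rX g = w'}].
Proof.
move=> /subsetP sDG [modU /mx_rsim_sym[B _ freeB homB]] w0 wD.
exists (val_submod (w *m B)); split; last 2 first.
- exact: val_submodP.
- by move=> g gD; rewrite -(val_submodJ modU) ?sDG // -mulmxA -homB ?sDG // mulmxA wD.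
by rewrite val_submod_eq0 mulmx_free_eq0.
Qed.

Hypothesis rS_irr : mx_irreducible rS.
Variable A : 'M[K]_(p, q).
Hypothesis A_hom : {in G, forall g, rS g *m A = A *m rX g}.
Hypothesis A_neq0 : A != 0.

(** As in Schur's lemma, the kernel of [A] is a proper submodule of a simple module, hence zero. *)
Lemma simple_image_submod_iso : submod_iso rX rS <<A>>%MS.
Proof.
have freeA : row_free A.
  rewrite -kermx_eq0; apply: contraNT A_neq0 => ker0.
  have /mx_irrP[_ irr] := rS_irr; have /row_fullP[B BE] : row_full (kermx A).
    apply: irr ker0; apply/mxmoduleP => g Gg; apply/sub_kermxP.
    by rewrite -mulmxA A_hom // mulmxA mulmx_ker mul0mx.
  by rewrite -[A]mul1mx -BE -mulmxA mulmx_ker mulmx0.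
have modA : mxmodule rX <<A>>%MS.
  apply/mxmoduleP => g Gg; rewrite genmxE (eqmxMr _ (genmxE A)) -A_hom //.
  exact: submxMl.
exists modA; apply: mx_rsim_sym; exists (in_submod <<A>>%MS A).
- by rewrite mxrank_gen; apply/esym/eqP.
- by rewrite /row_free mxrank_in_submod ?genmxE.
move=> g Gg; rewrite -(in_submodJ modA) ?genmxE // -A_hom //.
by rewrite in_submodE [RHS]in_submodE mulmxA.
Qed.

End SimpleImage.

(** * Fixed vectors and Specht constituents *)

Section HighestSpecht.
Local Open Scope ring_scope.

Variables (K : fieldType) (T : finType) (d : nat).
Hypothesis charK : [pchar K] =i pred0.
Variables (X : mx_representation K [set: {perm T}] d) (e : 'rV[K]_d) (F0 : T -> nat).

(** Lexicographic comparison of contents: at the first colour where the class sizes differ, that of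
    [F] is the larger. *)
Definition lex_ge (F : T -> nat) := forall a,
  (forall b, (b < a)%N -> #|[set x | F x == b]| = #|[set x | F0 x == b]|) ->
  (#|[set x | F0 x == a]| <= #|[set x | F x == a]|)%N.

Hypothesis e_gen : forall U : 'M_d, mxmodule X U -> (e <= U)%MS -> (1%:M <= U)%MS.
Hypothesis e_marked : forall F, e *m symz X F != 0 -> lex_ge F ->
  exists2 g, g \in line_stab X e & forall x, F (g x) = F0 x.
Hypothesis e_symz : e *m symz X F0 != 0.

Lemma card_color_stab_neq0 (F : T -> nat) : #|color_stab F|%:R != 0 :> K.
Proof.
rewrite (natr_eq0 charK) -lt0n; apply/card_gt0P; exists 1%g; exact: group1.
Qed.

(** A fixed [w] is a multiple of w a_F; expand [w] in the translates e g and move a_F past g by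
    [symz_comp]. *)
Lemma fixed_vec_span F (w : 'rV[K]_d) : {in color_stab F, forall h, w *m X h = w} ->
  exists c : {perm T} -> K, w = \sum_g c g *: (e *m symz X (F \o g) *m X g).
Proof.
move=> wF; have [c cE] := cyclic_span e_gen w.
exists (fun g => #|color_stab F|%:R^-1 * c g).
rewrite -[LHS](scalerK (card_color_stab_neq0 F)) -(symz_fixed wF) {1}cE.
rewrite mulmx_suml scaler_sumr; apply: eq_big => [g | g _]; first by rewrite inE.
by rewrite -scalemxAl scalerA -!mulmxA symz_comp.
Qed.

(** Some term of the expansion of [w] is nonzero, and [e_marked] then makes a rearrangement of [F]
    equal to [F0]. *)
Lemma fixed_vec_content F (w : 'rV[K]_d) : lex_ge F -> w != 0 ->
  {in color_stab F, forall h, w *m X h = w} ->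
  forall a, #|[set x | F x == a]| = #|[set x | F0 x == a]|.
Proof.
move=> F_lex w0 wF a; have [c wE] := fixed_vec_span wF.
have [/existsP[g eg] | none] := boolP [exists g : {perm T}, e *m symz X (F \o g) != 0]; last first.
  case/eqP: w0; rewrite wE big1 // => g _; have : e *m symz X (F \o g) == 0.
    by apply: contraR none => eg; apply/existsP; exists g.
  by move/eqP->; rewrite mul0mx scaler0.
have [|h _ hE] := e_marked eg.
  move=> b H; rewrite card_comp_perm; apply: F_lex => b' lt_b.
  by rewrite -(card_comp_perm F g) H.
rewrite -(card_comp_perm F (h * g)%g); congr #|pred_of_set _|.
by apply/setP => x; rewrite !inE permM -hE.
Qed.

Local Notation v := (e *m symz X F0).

(** In a nonzero term, g is an element of [line_stab] followed by one of S_F0, so e g a_F0 is [v] up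
    to sign. *)
Lemma fixed_vec_line (w : 'rV[K]_d) : {in color_stab F0, forall h, w *m X h = w} -> (w <= v)%MS.
Proof.
move=> wF; have [c ->] := fixed_vec_span wF; apply: summx_sub => g _; apply: scalemx_sub.
have [-> | eg] := eqVneq (e *m symz X (F0 \o g)) 0; first by rewrite mul0mx sub0mx.
have [|h hN hE] := e_marked eg.
  by move=> b H; rewrite card_comp_perm.
have hgF : (h * g)%g \in color_stab F0 by apply/color_stabP => x; rewrite permM; exact: hE.
have /line_stabP[b bE] := groupVr hN.
rewrite -mulmxA -symz_comp -[g](mulKg h) repr_permM -!mulmxA (Msymz X hgF) mulmxA bE.
by rewrite -scalemxAl scalemx_sub.
Qed.

Lemma top_vec_fixed : {in color_stab F0, forall h, v *m X h = v}.
Proof. by move=> h hF; rewrite -mulmxA symzM. Qed.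

Definition raise_coloring (x : T) (i : nat) (z : T) := if z == x then i else F0 z.

(** Let [F1] be [F0] with [x] recoloured by the smaller colour [i]. The left side is the sum over
    the class [A] of colour [i] in [F1], with [z = x] giving [v]. It is fixed by S_F1, and the
    content of [F1] is strictly greater, so it vanishes by [fixed_vec_content]. *)
Lemma top_vec_raise x i : (i < F0 x)%N -> v + \sum_(z | F0 z == i) v *m X (tperm z x) = 0.
Proof.
move=> lt_i; pose F1 := raise_coloring x i.
pose A := [set z | F1 z == i].
have AE z : (z \in A) = (z == x) || (F0 z == i).
  by rewrite inE /F1 /raise_coloring; case: (eqVneq z x) => _; rewrite ?eqxx.
pose w := \sum_(z in A) v *m X (tperm z x).
have -> : v + \sum_(z | F0 z == i) v *m X (tperm z x) = w.
  rewrite /w [RHS](bigD1 x) /= ?AE ?eqxx // tperm1 repr_mx1 mulmx1; congr (_ + _).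
  apply: eq_bigl => z; rewrite AE; case: (eqVneq z x) => [-> | _] /=; last by rewrite andbT.
  exact: gtn_eqF.
apply/eqP; apply: contraT => w0.
have F0E z u : z \in A -> F0 (tperm z x u) = if u == z then F0 x else F1 u.
  rewrite AE /F1 /raise_coloring => /orP zA; case: tpermP => [-> | -> | /eqP uz /eqP ux].
  - by rewrite eqxx.
  - case: (eqVneq x z) => [-> // | nxz]; rewrite eqxx.
    by case: zA => /eqP // zx; rewrite zx eqxx in nxz.
  by rewrite (negPf uz) (negPf ux).
have wF1 : {in color_stab F1, forall h, w *m X h = w}.
  move=> h /color_stabP hF1; rewrite /w mulmx_suml.
  rewrite [RHS](reindex_inj (@perm_inj _ h)) /=; apply: eq_big => [z | z zA].
    by rewrite !inE hF1.
  have hzA : h z \in A by move: zA; rewrite !inE hF1.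
  (* Hence [h] takes the term of [z] to the term of [h z], as [v] is fixed by S_F0. *)
  have gF0 : (tperm z x * h * tperm (h z) x)%g \in color_stab F0.
    apply/color_stabP => u; rewrite !permM F0E // (inj_eq perm_inj) hF1 -F0E //.
    by rewrite tpermK.
  rewrite -[in RHS](top_vec_fixed gF0) -!mulmxA -!repr_permM; congr (_ *m (_ *m X _)).
  by rewrite -mulgA tperm2 mulg1.
have content0 b : b != i -> b != F0 x -> #|[set z | F1 z == b]| = #|[set z | F0 z == b]|.
  move=> bi bx; congr #|pred_of_set _|; apply/setP => z; rewrite !inE /F1 /raise_coloring.
  by case: (eqVneq z x) => [-> | //]; rewrite ![_ == b]eq_sym (negPf bi) (negPf bx).
have contenti : #|[set z | F1 z == i]| = #|[set z | F0 z == i]|.+1.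
  rewrite (cardsD1 x) inE /F1 /raise_coloring eqxx eqxx add1n; congr _.+1.
  congr #|pred_of_set _|; apply/setP => z; rewrite !inE.
  by case: (eqVneq z x) => [-> | //] /=; rewrite gtn_eqF.
have F1_lex : lex_ge F1.
  move=> a H; case: (ltngtP a i) => [lt_a | lt_a | ->]; last by rewrite contenti.
    by rewrite content0 // ltn_eqF // (ltn_trans lt_a).
  by have := H i lt_a; rewrite contenti => /esym/eqP; rewrite ltn_eqF.
by have := fixed_vec_content F1_lex w0 wF1 i; rewrite contenti => /esym/eqP; rewrite ltn_eqF.
Qed.

Variable la : seq nat.
Hypothesis la_part : is_partition #|T| la.
Variable t : {ffun T -> position la}.
Hypotheses (t_tab : is_tableau t) (t_row : forall x, tab_row t x = F0 x).

Local Notation M := (tabloid_repr K T la).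
Local Notation S := (specht_mx K T la).
Local Notation rS := (specht_repr K T la).
Local Notation t0 := (tab_of la_part t_tab).

Lemma color_stab_row : color_stab (tab_row t) = color_stab F0.
Proof. by apply/setP => g; apply/color_stabP/color_stabP => H x; have := H x; rewrite !t_row. Qed.

Lemma top_vec_antisymz : v *m antisymz X (tab_col t) setT != 0.
Proof.
apply: (antisymz_neq0 (tab_row_col_inj t_tab) (tableau_left la_part t_tab)) => //.
  by rewrite color_stab_row; exact: top_vec_fixed.
move=> x i; rewrite t_row => lt_i; rewrite -[RHS](top_vec_raise lt_i); congr (_ + _).
by apply: eq_bigl => z; rewrite t_row.
Qed.

(** The homomorphism from M^la that sends [t0] to [v]. The choice of [g] is immaterial because [v]
    is fixed by the row stabilizer; the default 1 is never reached, the action on tabloids being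
    transitive. *)
Definition tabloid_hom : 'M[K]_(#|{: tabloid T la}|, d) :=
  \matrix_j (v *m X (odflt 1%g [pick g | tabloid_act t0 g == enum_val j])).

Lemma tabloid_homE g : tab_delta K t0 *m M g *m tabloid_hom = v *m X g.
Proof.
rewrite tab_delta_act -rowE rowK enum_rankK.
case: pickP => [h /eqP hE | /(_ g)]; last by rewrite eqxx.
have hgF : (h * g^-1)%g \in color_stab F0.
  apply/color_stabP => x; rewrite permM -!t_row.
  have /(congr1 (fun f : tabloid T la => val f (h x))) := hE.
  by rewrite /= !ffunE permK /tab_row => ->.
by rewrite /= -[h](mulgKV g) repr_permM mulmxA top_vec_fixed.
Qed.

Lemma tabloid_hom_comm g : M g *m tabloid_hom = tabloid_hom *m X g.
Proof.
apply/row_matrixP => i; rewrite !row_mul [row i tabloid_hom]rowE rowE.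
have [h hE] := tabloid_transitive la_part t_tab (enum_val i).
have -> : delta_mx 0 i = tab_delta K t0 *m M h.
  by rewrite tab_delta_act hE /tab_delta enum_valK.
rewrite tabloid_homE; have := tabloid_homE (h * g)%g.
by rewrite !repr_permM !mulmxA.
Qed.

Lemma polytabloid_hom : polytabloid K t *m tabloid_hom = v *m antisymz X (tab_col t) setT.
Proof.
set w := v; rewrite (polytabloid_antisymz K la_part t_tab) /antisymz !mulmx_sumr mulmx_suml.
by apply: eq_bigr => g _; rewrite -!scalemxAr -scalemxAl tabloid_homE.
Qed.

Lemma specht_irr : mx_irreducible rS.
Proof. exact: (submod_mx_irr (specht_module K T la)).2 (specht_simple charK la_part t_tab). Qed.

(** [U] is the image of the Specht module under [tabloid_hom]; it is nonzero by [polytabloid_hom]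
    and [top_vec_antisymz]. *)
Lemma exists_specht_submod : exists U : 'M_d, submod_iso X rS U.
Proof.
exists <<val_submod (1%:M : 'M_(\rank S)) *m tabloid_hom>>%MS.
apply: simple_image_submod_iso; first exact: specht_irr.
  move=> g _; rewrite mulmxA -val_submodE -mulmxA -tabloid_hom_comm mulmxA.
  by rewrite -[in RHS](val_submodJ (specht_module K T la)) ?inE // mul1mx.
apply: contra_neq top_vec_antisymz => A0; rewrite -polytabloid_hom.
have /submxP[w ->] : (polytabloid K t <= val_submod (1%:M : 'M_(\rank S)))%MS.
  by rewrite val_submod1 polytabloid_specht.
by rewrite -mulmxA A0 mulmx0.
Qed.

Lemma top_vec_specht_submod (U : 'M_d) : submod_iso X rS U -> (v <= U)%MS.
Proof.
move=> isoU; have [w w0 wF] := specht_fixed_vec charK la_part t_tab.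
have [w' [w'0 w'U w'F]] := submod_iso_fixed (subsetT _) isoU w0 wF.
rewrite color_stab_row in w'F.
have /sub_rVP[c w'E] := fixed_vec_line w'F.
have c0 : c != 0 by apply: contraNneq w'0 => c0; rewrite w'E c0 scale0r.
by rewrite -(eqmx_scale _ c0) -w'E.
Qed.

Lemma submod_iso_simple (U : 'M_d) : submod_iso X rS U -> mxsimple X U.
Proof.
case=> modU /mx_rsim_sym isoU; apply/(submod_mx_irr modU).
exact: mx_rsim_irr isoU specht_irr.
Qed.

(** [U] and a copy of the Specht module share the nonzero vector [v]; both being simple, they
    coincide. *)
Lemma simple_specht_submod (U : 'M_d) : mxsimple X U -> (v <= U)%MS -> submod_iso X rS U.
Proof.
move=> simU vU; have [U1 isoU1] := exists_specht_submod.
have simU1 := submod_iso_simple isoU1; have vU1 := top_vec_specht_submod isoU1.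
have [[modU nzU minU] [modU1 nzU1 minU1]] := (simU, simU1).
have UU1_0 : (U :&: U1)%MS != 0.
  apply: contraNneq e_symz => UU1; rewrite -submx0 -UU1 sub_capmx vU vU1 //.
have modUU1 : mxmodule X (U :&: U1)%MS by rewrite capmx_module.
have sU : (U <= U1)%MS := submx_trans (minU _ modUU1 (capmxSl _ _) UU1_0) (capmxSr _ _).
have sU1 : (U1 <= U)%MS := submx_trans (minU1 _ modUU1 (capmxSr _ _) UU1_0) (capmxSl _ _).
have [modU1' iso1] := isoU1; exists modU; apply: mx_rsim_trans iso1.
by apply/mx_rsim_iso; apply: eqmx_iso; apply/eqmxP; rewrite sU sU1.
Qed.

Lemma specht_summand : is_summand X rS.
Proof.
have [U isoU] := exists_specht_submod; have [modU _ _] := submod_iso_simple isoU.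
have [W modW defW dxW] := mx_Maschke_pchar X (pchar0_pgroup charK _) modU (submx1 _).
by exists U, W; split.
Qed.

(** Every summand isomorphic to the Specht module contains [v], and in a direct sum at most one
    summand can. One does: some component of [v] survives symmetrization, which makes it a nonzero
    multiple of [v]. *)
Lemma specht_multiplicity1 : has_multiplicity X rS 1.
Proof.
(* Semisimplicity comes under [classically], which can be opened when the goal is a boolean. *)
apply: NNPP => no_mult; suff: false by [].
have := mx_reducible_semisimple (mxmodule1 X) (mx_Maschke_pchar X (pchar0_pgroup charK _)).
move/(_ false); apply => -[I U /= simU defU dxU]; case: no_mult.
pose r := #|I|; pose U' (i : 'I_r) := U (enum_val i).
have sumU' : (\sum_i U' i)%MS = (\sum_i U i)%MS.
  by rewrite [RHS](reindex (@enum_val I predT)) //; apply: onW_bij; exact: enum_val_bij.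
have sumU1 : (\sum_i U' i :=: 1%:M)%MS by rewrite sumU'.
have dxU' : mxdirect (\sum_i U' i).
  rewrite mxdirectE /= sumU'; move: dxU; rewrite mxdirectE /= => /eqP->.
  rewrite [X in X == _](reindex (@enum_val I predT)) //; apply: onW_bij; exact: enum_val_bij.
have /sub_sumsmxP[u vE] : (v <= \sum_i U' i)%MS by rewrite sumU1 submx1.
have [i0 vi0] : exists i, (v <= U' i)%MS.
  have [/existsP[i ui] | none] := boolP [exists i, u i *m U' i *m symz X F0 != 0].
    have uF : {in color_stab F0, forall h,
      u i *m U' i *m symz X F0 *m X h = u i *m U' i *m symz X F0}.
      by move=> h hF; rewrite -mulmxA symzM.
    have /sub_rVP[c uE] := fixed_vec_line uF.
    have c0 : c != 0 by apply: contraNneq ui => c0; rewrite uE c0 scale0r.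
    exists i; rewrite -(eqmx_scale _ c0) -uE mulmx_sumr summx_sub // => h _.
    have [modUi _ _] := simU (enum_val i).
    by rewrite mxmodule_trans ?inE ?submxMl.
  case/eqP: e_symz; apply/eqP; rewrite -(inj_eq (scalerI (card_color_stab_neq0 F0))).
  rewrite scaler0 -(symz_fixed top_vec_fixed) {1}vE mulmx_suml big1 // => i _.
  by apply/eqP; apply: contraR none => ui; apply/existsP; exists i.
exists r, U', [set i0]; split=> // [i | i |]; last by rewrite cards1.
- exact: simU.
split=> [/set1P-> | isoUi]; first by apply: simple_specht_submod vi0; exact: simU.
rewrite inE; apply: contraT => nii0; have vi := top_vec_specht_submod isoUi.
case/eqP: e_symz; apply/eqP; rewrite -submx0.
have /mxdirect_sumsP/(_ i isT) <- := dxU'.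
by rewrite sub_capmx vi (sumsmx_sup i0) // eq_sym.
Qed.

Lemma summand_content (ka : seq nat) : is_partition #|T| ka ->
  is_summand X (specht_repr K T ka) ->
  (forall a, (forall b, (b < a)%N -> nth 0 ka b = nth 0 la b) -> (nth 0 la a <= nth 0 ka a)%N) ->
  forall a, nth 0 ka a = nth 0 la a.
Proof.
move=> ka_part [U [W [isoU _ _ _]]] lex_ka.
have [t' t'_tab] := exists_tableau ka_part.
have [w w0 wF] := specht_fixed_vec charK ka_part t'_tab.
have [w' [w'0 w'U w'F]] := submod_iso_fixed (subsetT _) isoU w0 wF.
have cF0 a : #|[set x | F0 x == a]| = nth 0 la a.
  by rewrite -(card_tab_row la_part t_tab); congr #|pred_of_set _|; apply/setP => x; rewrite !inE t_row.
have lexF : lex_ge (tab_row t').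
  move=> a H; rewrite cF0 (card_tab_row ka_part t'_tab); apply: lex_ka => b lt_b.
  by rewrite -cF0 -H // (card_tab_row ka_part t'_tab).
move=> a; rewrite -cF0 -(fixed_vec_content lexF w'0 w'F).
by rewrite (card_tab_row ka_part t'_tab).
Qed.

End HighestSpecht.

(** * The shape of the highest constituent *)

(** This turns the order on sequences into the comparison used in [lex_ge], with 0 for missing
    entries. *)
Lemma seqlexi_nth (s r : seq nat) : ((s : seqlexi nat) <= (r : seqlexi nat))%O ->
  forall a, (forall b, b < a -> nth 0 r b = nth 0 s b) -> nth 0 s a <= nth 0 r a.
Proof.
elim: s r => [|x s IH] r; first by move=> _ a _; rewrite nth_nil.
case: r => [|z r] //; rewrite Order.SeqLexiOrder.lexi_cons.
case/andP => lexz /implyP lesr [|a] H //=.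
have zx : z = x := H 0 (ltn0Sn a).
apply: IH => [|b lt_b]; first by apply: lesr; rewrite zx.
exact: (H b.+1).
Qed.

(** As parts are positive, the default value 0 marks the end of a partition. *)
Lemma eq_partition N (s r : seq nat) : is_partition N s -> is_partition N r ->
  (forall a, nth 0 s a = nth 0 r a) -> s = r.
Proof.
move=> /and3P[_ s0 _] /and3P[_ r0 _] E.
suff le p q : 0 \notin p -> (forall a, nth 0 p a = nth 0 q a) -> size p <= size q.
  by apply: (@eq_from_nth _ 0) => // ; apply/eqP; rewrite eqn_leq !le.
move=> p0 pq; rewrite leqNgt; apply: contra p0 => lt_qp.
by rewrite -(nth_default 0 (leqnn (size q))) -pq mem_nth.
Qed.

Section Shape.
Local Open Scope nat_scope.

Variables (m n : nat).
Hypotheses (m_gt0 : 0 < m) (n_gt0 : 0 < n).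
Variables (mu nu : seq nat).
Hypotheses (mu_part : is_partition #|'I_m| mu) (nu_part : is_partition #|'I_n| nu).

Local Notation k := (size mu).-1.
Local Notation l := (size nu).

Definition foulkes_shape : seq nat :=
  [seq n * nth 0 mu i | i <- iota 0 k]
    ++ (n * (nth 0 mu k - 1) + nth 0 nu 0) :: [seq nth 0 nu j | j <- iota 1 l.-1].

Lemma size_partition_gt0 (N : nat) s : 0 < N -> is_partition N s -> 0 < size s.
Proof. by case: s => // N0 /and3P[_ _ /eqP E]; rewrite -E in N0. Qed.

Let mu_gt0 : 0 < size mu. Proof. by apply: size_partition_gt0 mu_part; rewrite card_ord. Qed.
Let nu_gt0 : 0 < l. Proof. by apply: size_partition_gt0 nu_part; rewrite card_ord. Qed.

Lemma nth_foulkes_shape a : nth 0 foulkes_shape a =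
  if a < k then n * nth 0 mu a
  else if a == k then n * (nth 0 mu k - 1) + nth 0 nu 0 else nth 0 nu (a - k).
Proof.
rewrite nth_cat size_map size_iota; case: ltnP => [lt_a | le_a].
  by rewrite (nth_map 0) ?size_iota // nth_iota.
case: eqP => [-> | nak]; first by rewrite subnn.
have -> : a - k = (a - k).-1.+1 by lia.
move: (a - k).-1 => b /=.
have [lt_b | le_b] := ltnP b l.-1; first by rewrite (nth_map 0) ?size_iota // nth_iota.
rewrite !nth_default ?size_map ?size_iota //; lia.
Qed.

Lemma nth_nu_le i : nth 0 nu i <= n.
Proof.
rewrite (leq_trans (partition_nth_mono nu_part (leq0n i))) // -[leqRHS]card_ord.
have /and3P[_ _ /eqP<-] := nu_part.
by case: (nu) => //= b r; rewrite leq_addr.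
Qed.

Lemma nth_mu_gt0 : 0 < nth 0 mu k.
Proof. by rewrite (partition_nth_gt0 mu_part) ltn_predL. Qed.

Lemma size_foulkes_shape : size foulkes_shape = k + l.
Proof. by rewrite size_cat /= !size_map !size_iota prednK. Qed.

Lemma foulkes_shape_part : is_partition (m * n) foulkes_shape.
Proof.
have mu1 := nth_mu_gt0.
apply/and3P; split.
- apply/(sortedP 0) => i; rewrite size_foulkes_shape /= !nth_foulkes_shape => lt_i.
  have := partition_nth_mono mu_part (leqnSn i); have := nth_nu_le 0.
  have := partition_nth_mono nu_part (leqnSn (i - k)).
  case: (ltngtP i k) => [lt_ik | lt_ki | ->]; rewrite ?ltnn ?eqxx.
  + case: (ltngtP i.+1 k) => [lt_ik' _ _ | | E]; [ | lia | ].
      by rewrite leq_mul2l => ->; rewrite orbT.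
    (* At the step into position [k], the inequality n mu_i >= n mu_k = n (mu_k - 1) + n is combined
       with nu_0 <= n. *)
    move=> _ nu_n; rewrite -E in mu1 * => mu_le.
    rewrite mulnBr muln1; have := leq_mul (leqnn n) mu_le; have := leq_mul (leqnn n) mu1; lia.
  + have -> : (i.+1 < k) = false by lia.
    have -> : (i.+1 == k) = false by lia.
    by rewrite subSn // ltnW.
  have -> : (k.+1 < k) = false by lia.
  have -> : (k.+1 == k) = false by lia.
  rewrite subnn subSnn => h _ _; apply: leq_trans h _; exact: leq_addl.
- apply/negP => /(nthP 0)[i]; rewrite size_foulkes_shape nth_foulkes_shape => lt_i.
  case: ltnP => [lt_ik | le_ki].
    move/eqP; rewrite muln_eq0 => /orP[|]; first by rewrite gtn_eqF.
    by rewrite gtn_eqF // (partition_nth_gt0 mu_part) (leq_trans lt_ik) // leq_pred.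
  have pos j : j < l -> 0 < nth 0 nu j by rewrite -(partition_nth_gt0 nu_part).
  case: (eqVneq i k) => [_ /eqP | nik /eqP].
    by rewrite addn_eq0 => /andP[_]; rewrite gtn_eqF // pos.
  by rewrite gtn_eqF // pos //; lia.
have /and3P[_ _ /eqP mu_sum] := mu_part; have /and3P[_ _ /eqP nu_sum] := nu_part.
rewrite !card_ord in mu_sum nu_sum.
have mu_split : sumn mu = \sum_(0 <= i < k) nth 0 mu i + nth 0 mu k.
  by rewrite -big_nat_recr //= (prednK mu_gt0) sumnE (big_nth 0).
have nu_split : sumn nu = nth 0 nu 0 + \sum_(1 <= i < l) nth 0 nu i.
  by rewrite -big_ltn // sumnE (big_nth 0).
rewrite /foulkes_shape sumn_cat /= !sumnE !big_map.
have -> : iota 0 k = index_iota 0 k by rewrite /index_iota subn0.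
have -> : iota 1 l.-1 = index_iota 1 l by rewrite /index_iota subn1.
rewrite -big_distrr /=; move: mu_split nu_split; rewrite mu_sum nu_sum.
set A := \sum_(i <- _) _; set B := \sum_(i <- _) _ => mu_split nu_split.
(* The amount n removed from the last multiple is restored by the parts of nu, whose sum is n. *)
rewrite mulnBr muln1 mu_split mulnDl [in n]nu_split.
have := leq_mul (leqnn n) mu1; nia.
Qed.


Variables (t : {ffun 'I_m -> position mu}) (s : {ffun 'I_n -> position nu}).
Hypotheses (t_tab : is_tableau t) (s_tab : is_tableau s).
Variable y : 'I_m.
Hypothesis y_last : tab_row t y = k.

(** Without its mark, row [k] keeps mu_k - 1 boxes in each copy; the marks add the parts of nu,
    shifted by [k]. *)
Lemma marked_content a :
  #|[set p | marked_coloring (tab_row t) k y (tab_row s) p == a]| = nth 0 foulkes_shape a.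
Proof.
rewrite card_marked_coloring // nth_foulkes_shape.
have -> : #|[set p : 'I_n * 'I_m | (p.2 != y) && (tab_row t p.2 == a)]| =
          n * (nth 0 mu a - (k == a)).
  have -> : [set p : 'I_n * 'I_m | (p.2 != y) && (tab_row t p.2 == a)] =
            setX [set: 'I_n] ([set x | tab_row t x == a] :\ y).
    by apply/setP => -[i x]; rewrite !inE.
  rewrite cardsX cardsT card_ord; congr (_ * _).
  rewrite -(card_tab_row mu_part t_tab) (cardsD1 y [set x | tab_row t x == a]) inE y_last.
  by rewrite addKn.
rewrite (card_tab_row nu_part s_tab).
case: (ltngtP a k) => [lt_a | lt_a | ->].
- by rewrite subn0 addn0.
- by rewrite nth_default ?muln0 //; rewrite -(prednK mu_gt0).
by rewrite subnn.
Qed.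

End Shape.

Section FoulkesMain.
Local Open Scope ring_scope.

Variables (m n : nat) (m_gt0 : (0 < m)%N) (n_gt0 : (0 < n)%N).
Variables (mu nu : seq nat).
Hypotheses (mu_part : is_partition #|'I_m| mu) (nu_part : is_partition #|'I_n| nu).
Variable K : fieldType.
Hypothesis charK : [pchar K] =i pred0.

Local Notation X := (foulkes_gen n m_gt0 mu nu K).
Local Notation T := ('I_n * 'I_m)%type.
Local Notation la := (foulkes_shape n mu nu).

Theorem foulkes_highest :
  [/\ is_summand X (specht_repr K T la), has_multiplicity X (specht_repr K T la) 1
    & forall ka, is_partition #|{: T}| ka -> is_summand X (specht_repr K T ka) ->
        (forall a, (forall b, (b < a)%N -> nth 0 ka b = nth 0 la b) -> (nth 0 la a <= nth 0 ka a)%N) ->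
        forall a, nth 0 ka a = nth 0 la a].
Proof.
have [t t_tab] := exists_tableau mu_part; have [s s_tab] := exists_tableau nu_part.
(* The mark is the first box of the last row of [t]. *)
have [y [y_last _]] := tableau_onto_nat mu_part t_tab (nth_mu_gt0 m_gt0 mu_part).
pose F0 := marked_coloring (tab_row t) (size mu).-1 y (tab_row s).
have cF0 a : #|[set p | F0 p == a]| = nth 0%N la a by exact: marked_content.
have la_part : is_partition #|{: T}| la.
  by rewrite card_prod !card_ord mulnC; apply: foulkes_shape_part.
have [t' t'_tab t'_row] := exists_tableau_rows la_part cF0.
pose e := foulkes_vec K t s.
have e_gen p (U : 'M_(p, _)) : mxmodule X U -> (e <= U)%MS -> (1%:M <= U)%MS.
  exact: (foulkes_vec_generated mu_part nu_part t_tab s_tab).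
have e_symz : e *m symz X F0 != 0.
  exact: (foulkes_symz_neq0 m_gt0 mu_part nu_part charK t_tab s_tab (@tab_row_le_last m mu t) y_last).
have e_marked F : e *m symz X F != 0 -> lex_ge F0 F ->
    exists2 g, g \in line_stab X e & forall p, F (g p) = F0 p.
  exact: (marked_of_symz_neq0 mu_part nu_part charK t_tab s_tab
    (foulkes_vec_col m_gt0 K s t_tab) (foulkes_vec_swap m_gt0 K s t_tab)
    (foulkes_vec_transpose m_gt0 K t s_tab) y_last).
split.
- exact: (specht_summand charK (e_gen _) e_marked e_symz la_part t'_tab t'_row).
- exact: (specht_multiplicity1 charK (e_gen _) e_marked e_symz la_part t'_tab t'_row).
move=> ka ka_part ka_sum.
exact: (summand_content charK (e_gen _) e_marked la_part t'_tab t'_row ka_part ka_sum).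
Qed.

End FoulkesMain.

Theorem corollary9p1 (m n : nat) (m_gt0 : 0 < m) (n_gt0 : 0 < n)
    (mu nu : seq nat) (k l : nat)
    (mu_part : is_partition m mu) (mu_size : size mu = k)
    (nu_part : is_partition n nu) (nu_size : size nu = l) :
  let H := foulkes_repr n m_gt0 mu nu in
  let S (la : seq nat) := specht_repr rat ('I_n * 'I_m)%type la in
  let la : seq nat :=
    [seq n * nth 0 mu i | i <- iota 0 k.-1]
      ++ (n * (nth 0 mu k.-1 - 1) + nth 0 nu 0)
      :: [seq nth 0 nu j | j <- iota 1 l.-1] in
  [/\ is_partition (m * n) la,
      is_summand H (S la),
      forall ka : seq nat, is_partition (m * n) ka -> is_summand H (S ka) ->
        ((ka : seqlexi nat) <= (la : seqlexi nat))%O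
    & has_multiplicity H (S la) 1].
Proof.
move=> H S la; subst k l; rewrite -[m]card_ord in mu_part; rewrite -[n]card_ord in nu_part.
have la_part : is_partition (m * n) la by exact: (foulkes_shape_part m_gt0 n_gt0 mu_part nu_part).
have char_rat : [pchar rat]%R =i pred0 := Num.Theory.pchar_num rat.
have [la_sum la_mult la_max] := foulkes_highest m_gt0 n_gt0 mu_part nu_part char_rat.
split; [exact: la_part | exact: la_sum | | exact: la_mult].
(* If [ka] were greater than [la], then [la_max] would give it the same parts, a contradiction. *)
move=> ka ka_part ka_sum; case: (Order.TotalTheory.leP (ka : seqlexi nat) la) => // lt_la.
have card_T : #|{: 'I_n * 'I_m}| = m * n by rewrite card_prod !card_ord mulnC.
have ka_la : forall a, nth 0 ka a = nth 0 la a.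
  by apply: (la_max ka); [rewrite card_T | exact: ka_sum | exact: seqlexi_nth (Order.POrderTheory.ltW lt_la)].
by rewrite (eq_partition ka_part la_part ka_la) Order.POrderTheory.ltxx in lt_la.
Qed.
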